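(* Let $\mathbf{A}=(A,\mu,\alpha)$ be a system whose state $\mu$ is a trace, and let $\mathbf{F}=(F,\lambda,\varphi)$ be a modular subsystem of $\mathbf{A}$. Then $\mathbf{A}$ is weakly mixing relative to $\mathbf{F}$ if and only if the relative product system $\mathbf{A}\odot_{\mathbf{F}}\mathbf{A}'$ is ergodic relative to $\mathbf{F}$.
   Context: A system $\mathbf{A}=(A,\mu,\alpha)$ consists of a faithful normal state $\mu$ on a von Neumann algebra $A$ and a $*$-automorphism $\alpha$ of $A$ with $\mu\circ\alpha=\mu$. Without loss, $A$ acts on a Hilbert space $H$ with $\mu(a)=\langle\Omega,a\Omega\rangle$ for a cyclic and separating vector $\Omega\in H$ (inner products are linear in the second variable). The unitary $U$ on $H$ is defined by extending $Ua\Omega:=\alpha(a)\Omega$; then $UaU^*=\alpha(a)$ for $a\in A$. $J$ is the modular conjugation associated to $\mu$ and $j:B(H)\to B(H)$, $j(a):=Ja^*J$. A system $\mathbf{F}=(F,\lambda,\varphi)$ is a subsystem of $\mathbf{A}$ if $F$ is a von Neumann subalgebra of $A$ containing the unit of $A$, $\mu|_F=\lambda$ and $\alpha|_F=\varphi$ (so $\alpha(F)=F$). It is a modular subsystem if moreover $F$ is globally invariant under the modular group associated to $\mu$ (automatic when $\mu$ is a trace). For a modular subsystem, $D:A\to F$ denotes the unique conditional expectation with $\lambda\circ D=\mu$. Weak mixing: $\mathbf{A}$ is weakly mixing relative to $\mathbf{F}$ if $\lim_{N\to\infty}\frac1N\sum_{n=1}^N\lambda(|D(b\alpha^n(a))|^2)=0$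 for all $a,b\in A$ with $D(a)=D(b)=0$, where $|x|^2=x^*x$. Relative product: on the commutant $A'$ define $\mu'(b):=\mu\circ j(b)=\langle\Omega,b\Omega\rangle$ and $\alpha'(b):=UbU^*$; $\mathbf{A}'=(A',\mu',\alpha')$. Set $\tilde F:=j(F)\subset A'$ and $\tilde D:=j\circ D\circ j:A'\to\tilde F$ (a conditional expectation). With $\odot$ the algebraic tensor product, let $\delta:F\odot\tilde F\to B(H)$ be the unital $*$-homomorphism with $\delta(f\otimes\tilde f)=f\tilde f$, let $\Delta_\lambda(c):=\langle\Omega,\delta(c)\Omega\rangle$, let $E:=D\odot\tilde D$, and let $\omega=\mu\odot_\lambda\mu':=\Delta_\lambda\circ E$, a state on $A\odot A'$, invariant under $\tau:=\alpha\odot\alpha'$. The relative product system is $\mathbf{A}\odot_{\mathbf{F}}\mathbf{A}':=(A\odot A',\omega,\tau)$. Let $(H_\omega,\pi_\omega,\Omega_\omega)$ be the GNS representation of $(A\odot A',\omega)$ (by bounded operators), $\gamma_\omega(t):=\pi_\omega(t)\Omega_\omega$, and let $W$ be the unitary on $H_\omega$ extending $W\gamma_\omega(t):=\gamma_\omega(\tau(t))$. Let $H_\lambda:=\overline{\gamma_\omega(F\otimes1)}$ (which equals $\overline{\gamma_\omega(1\otimes\tilde F)}$), and $H_\omega^W$ the fixed point space of $W$. $\mathbf{A}\odot_{\mathbf{F}}\mathbf{A}'$ is ergodic relative to $\mathbf{F}$ if $H_\omega^W\subset H_\lambda$. *)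

(* Defs.v *)
From HB Require Import structures.
From mathcomp Require Import all_boot all_order all_algebra.
From mathcomp Require Import complex.
From mathcomp Require Import all_classical all_reals all_analysis.
Import Order.TTheory GRing.Theory Num.Theory.
Import numFieldNormedType.Exports.

Set Implicit Arguments.
Unset Strict Implicit.
Unset Printing Implicit Defensive.

Local Open Scope classical_set_scope.
Local Open Scope ring_scope.

(* Complex Hilbert spaces; inner products are linear in the second variable. *)
HB.mixin Record CompleteNormedModule_isHilbert (R : realType) H
    of CompleteNormedModule R[i] H := {
  inner : H -> H -> R[i] ;
  inner_conj : forall x y, inner y x = (inner x y)^* ;
  inner_linear : forall x (k : R[i]) y z,
    inner x (k *: y + z) = k * inner x y + inner x z ;
  inner_norm : forall x, inner x x = `|x| ^+ 2 }.

#[short(type="hilbertType")]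
HB.structure Definition Hilbert (R : realType) :=
  {H of CompleteNormedModule R[i] H & CompleteNormedModule_isHilbert R H}.

Section Operators.
Context {R : realType} {H : hilbertType R}.
Implicit Types (a b : H -> H) (A F S : set (H -> H)) (P : set (H * H)).

Definition bounded_op : set (H -> H) := [set a | linear a /\ continuous a].

(* The adjoint exists for every bounded operator, by the Riesz theorem. *)
Definition adj a : H -> H :=
  get [set b : H -> H | forall x y, inner (a x) y = inner x (b y)].

Definition unitary a : Prop :=
  [/\ linear a, forall x y, inner (a x) (a y) = inner x y & range a = setT].

Definition antiunitary a : Prop :=
  [/\ forall (k : R[i]) x y, a (k *: x + y) = k^* *: a x + a y,
      forall x y, inner (a x) (a y) = inner y x & range a = setT].

Definition positive_op a : Prop := forall x, 0 <= inner x (a x).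

Definition commutant S : set (H -> H) :=
  [set b | bounded_op b /\ forall a, S a -> a \o b = b \o a].

(* Von Neumann algebras on H, containing the identity of H. *)
Definition von_neumann A : Prop :=
  [/\ A `<=` bounded_op, forall a, A a -> A (adj a)
    & commutant (commutant A) = A].

Definition vector_state (Om : H) a : R[i] := inner Om (a Om).

(* Unbounded operators are given by their graphs.  A densely defined graph
   which is equal to the graph of its adjoint is linear and single-valued. *)
Definition domain P : set H := [set x | exists y, P (x, y)].

Definition positive_selfadjoint P : Prop :=
  [/\ closure (domain P) = setT,
      forall x y, P (x, y) <-> (forall u v, P (u, v) -> inner x v = inner y u)
    & forall x y, P (x, y) -> 0 <= inner x y].

Definition projection_op a : Prop :=
  [/\ bounded_op a, a \o a = a & forall x y, inner (a x) y = inner x (a y)].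

(* E is the spectral measure of the self-adjoint operator with graph P, and
   nu x is the scalar measure B |-> <x, E B x>. *)
Record is_spectral_measure P (E : set (measurableTypeR R) -> H -> H)
    (nu : H -> {measure set (measurableTypeR R) -> \bar R}) : Prop := {
  spectral_proj : forall B, measurable B -> projection_op (E B) ;
  spectral_setT : E setT = id ;
  spectral_nu : forall x B, measurable B ->
    nu x B = (complex.Re (inner x (E B x)))%:E ;
  spectral_domain : forall x,
    domain P x <-> (\int[nu x]_s ((s : R) ^+ 2)%:E < +oo)%E ;
  spectral_inner : forall x y, P (x, y) ->
    inner x y = Complex (\int[nu x]_s (s : R))%R 0 }.

End Operators.

(* A system in its GNS representation: the algebra A acts on H, and
   mu(a) = <Omega, a Omega> for a cyclic and separating unit vector Omega. *)
Record system (R : realType) := System {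
  sys_space : hilbertType R ;
  sys_alg : set (sys_space -> sys_space) ;
  sys_vac : sys_space ;
  sys_dyn : (sys_space -> sys_space) -> (sys_space -> sys_space) ;
  alg_von_neumann : von_neumann sys_alg ;
  vac_unit : `|sys_vac| = 1 ;
  vac_cyclic : closure [set a sys_vac | a in sys_alg] = setT ;
  vac_separating : forall a, sys_alg a -> a sys_vac = 0 -> a = 0 ;
  dyn_bij : set_bij sys_alg sys_alg sys_dyn ;
  dyn_linear : forall (k : R[i]) a b, sys_alg a -> sys_alg b ->
    sys_dyn (k *: a + b) = k *: sys_dyn a + sys_dyn b ;
  dyn_mul : forall a b, sys_alg a -> sys_alg b ->
    sys_dyn (a \o b) = sys_dyn a \o sys_dyn b ;
  dyn_adj : forall a, sys_alg a -> sys_dyn (adj a) = adj (sys_dyn a) ;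
  dyn_state : forall a, sys_alg a ->
    vector_state sys_vac (sys_dyn a) = vector_state sys_vac a }.

Definition state (R : realType) (S : system R)
    (a : sys_space S -> sys_space S) : R[i] :=
  vector_state (sys_vac S) a.
Arguments state {R} S a.
Arguments sys_alg {R} s.
Arguments sys_dyn {R} s _ _.

Definition tracial (R : realType) (S : system R) : Prop :=
  forall a b, sys_alg S a -> sys_alg S b -> state S (a \o b) = state S (b \o a).

(* The Tomita-Takesaki theory of the state of S.  The closure of
   a Omega |-> a^* Omega has polar decomposition J Delta^(1/2), and Delta^(it)
   is (s^2)^(it) = exp (i t ln (s^2)) evaluated at s = Delta^(1/2). *)
Record modular_data (R : realType) (S : system R) := ModularData {
  modular_conj : sys_space S -> sys_space S ;
  sqrt_Delta : set (sys_space S * sys_space S) ;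
  Delta_spectral : set (measurableTypeR R) -> sys_space S -> sys_space S ;
  Delta_meas : sys_space S -> {measure set (measurableTypeR R) -> \bar R} ;
  Delta_it : R -> sys_space S -> sys_space S ;
  modular_antiunitary : antiunitary modular_conj ;
  sqrt_Delta_positive : positive_selfadjoint sqrt_Delta ;
  tomita_polar :
    closure [set (a (sys_vac S), adj a (sys_vac S)) | a in sys_alg S] =
    [set (p.1, modular_conj p.2) | p in sqrt_Delta] ;
  Delta_spectralP : is_spectral_measure sqrt_Delta Delta_spectral Delta_meas ;
  Delta_it_bounded : forall t, bounded_op (Delta_it t) ;
  Delta_itP : forall t x, inner x (Delta_it t x) =
    Complex (\int[Delta_meas x]_s cos (t * ln ((s : R) ^+ 2)))%R
            (\int[Delta_meas x]_s sin (t * ln ((s : R) ^+ 2)))%R }.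

Section Subsystems.
Context {R : realType} {S : system R}.
Local Notation H := (sys_space S).
Local Notation A := (sys_alg S).
Local Notation Om := (sys_vac S).
Implicit Types (F : set (H -> H)) (D : (H -> H) -> (H -> H)) (U : H -> H).

Definition modular_group (M : modular_data S) (t : R) (a : H -> H) : H -> H :=
  Delta_it M t \o a \o Delta_it M (- t).

(* The state and the dynamics of a subsystem are the restrictions to F. *)
Definition subsystem F : Prop :=
  [/\ von_neumann F, F `<=` A & sys_dyn S @` F = F].

Definition modular_subsystem (M : modular_data S) F : Prop :=
  subsystem F /\ forall t, modular_group M t @` F = F.

(* The state-preserving conditional expectation from A onto F. *)
Record is_cond_exp F D : Prop := {
  cond_exp_in : forall a, A a -> F (D a) ;
  cond_exp_linear : forall (k : R[i]) a b, A a -> A b ->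
    D (k *: a + b) = k *: D a + D b ;
  cond_exp_id : forall f, F f -> D f = f ;
  cond_exp_module : forall f a g, F f -> A a -> F g ->
    D (f \o a \o g) = f \o D a \o g ;
  cond_exp_positive : forall a, A a -> positive_op (D (adj a \o a)) ;
  cond_exp_state : forall a, A a -> state S (D a) = state S a }.

(* |a|^2 = a^* a *)
Definition sqr_abs (a : H -> H) : H -> H := adj a \o a.

Definition relatively_weakly_mixing D : Prop :=
  forall a b, A a -> A b -> D a = 0 -> D b = 0 ->
  (fun N : nat => (N%:R)^-1 *
     \sum_(1 <= n < N.+1)
       state S (sqr_abs (D (b \o iter n (sys_dyn S) a)))
     : R[i]^o) @ \oo --> (0 : R[i]^o).

(* U is the unitary extending a Omega |-> alpha(a) Omega. *)
Definition implements_dyn U : Prop :=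
  unitary U /\ forall a, A a -> U (a Om) = sys_dyn S a Om.

Definition commutant_dyn U (b : H -> H) : H -> H := U \o b \o adj U.

(* j(a) = J a^* J *)
Definition mirror (M : modular_data S) (a : H -> H) : H -> H :=
  modular_conj M \o adj a \o modular_conj M.

Definition mirror_sub (M : modular_data S) F : set (H -> H) := mirror M @` F.

Definition mirror_exp (M : modular_data S) D : (H -> H) -> (H -> H) :=
  mirror M \o D \o mirror M.

End Subsystems.

Definition bilinear_on {R : realType} {H : hilbertType R}
    (A B : set (H -> H)) (X : lmodType R[i])
    (beta : (H -> H) -> (H -> H) -> X) : Prop :=
  (forall (k : R[i]) a a' b, A a -> A a' -> B b ->
     beta (k *: a + a') b = k *: beta a b + beta a' b) /\
  (forall (k : R[i]) a b b', A a -> B b -> B b' ->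
     beta a (k *: b + b') = k *: beta a b + beta a b').

(* The algebraic tensor product of two unital *-algebras A and B of operators
   on H, as a unital *-algebra with the universal property for bilinear maps.
   The values of tens outside A x B are irrelevant.  Such a tensor product is
   unique up to a unique *-isomorphism. *)
Record tensor_product {R : realType} {H : hilbertType R}
    (A B : set (H -> H)) := TensorProduct {
  tens_alg :> algType R[i] ;
  tens_star : tens_alg -> tens_alg ;
  tens : (H -> H) -> (H -> H) -> tens_alg ;
  tens_bilinear : bilinear_on A B tens ;
  tens_exists : forall (X : lmodType R[i]) (beta : (H -> H) -> (H -> H) -> X),
    bilinear_on A B beta ->
    exists f : {linear tens_alg -> X},
      forall a b, A a -> B b -> f (tens a b) = beta a b ;
  tens_unique : forall (X : lmodType R[i]) (f g : {linear tens_alg -> X}),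
    (forall a b, A a -> B b -> f (tens a b) = g (tens a b)) -> f =1 g ;
  tens_one : tens id id = 1 ;
  tens_mul : forall a a' b b', A a -> A a' -> B b -> B b' ->
    tens a b * tens a' b' = tens (a \o a') (b \o b') ;
  tens_star_semilinear : forall (k : R[i]) s t,
    tens_star (k *: s + t) = k^* *: tens_star s + tens_star t ;
  tens_starE : forall a b, A a -> B b ->
    tens_star (tens a b) = tens (adj a) (adj b) }.

Arguments tens {R H A B} _ _ _.

(* The linear map on the tensor product induced by a bilinear map. *)
Definition tens_lift {R : realType} {H : hilbertType R} {A B : set (H -> H)}
    (T : tensor_product A B) (X : lmodType R[i])
    (beta : (H -> H) -> (H -> H) -> X) : T -> X :=
  xget (fun=> 0) [set f : T -> X | linear f /\
    forall a b, A a -> B b -> f (tens T a b) = beta a b].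
Arguments tens_lift {R H A B} T {X} beta.

Record gns_triple {R : realType} {H : hilbertType R} {A B : set (H -> H)}
    (T : tensor_product A B) (omega : T -> R[i]) := GNSTriple {
  gns_space : hilbertType R ;
  gns_rep : T -> gns_space -> gns_space ;
  gns_vec : gns_space ;
  gns_bounded : forall t, bounded_op (gns_rep t) ;
  gns_linear : linear gns_rep ;
  gns_one : gns_rep 1 = id ;
  gns_mul : forall s t, gns_rep (s * t) = gns_rep s \o gns_rep t ;
  gns_star : forall t, gns_rep (tens_star t) = adj (gns_rep t) ;
  gns_cyclic : closure (range (fun t => gns_rep t gns_vec)) = setT ;
  gns_state : forall t, omega t = vector_state gns_vec (gns_rep t) }.
Arguments gns_rep {R H A B T omega} _ _ _.
Arguments gns_vec {R H A B T omega} _.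

Section RelativeProduct.
Context {R : realType} {S : system R} (M : modular_data S).
Local Notation H := (sys_space S).
Local Notation A := (sys_alg S).
Context {F : set (H -> H)} (D : (H -> H) -> (H -> H)) (U : H -> H).
Context (T : tensor_product A (commutant A)).
Context (TF : tensor_product F (mirror_sub M F)).

(* delta (f (x) f~) = f f~ *)
Definition delta : TF -> H -> H :=
  tens_lift TF (X := H -> H) (fun f g => f \o g).

Definition Delta_state (c : TF) : R[i] := state S (delta c).

Definition product_exp : T -> TF :=
  tens_lift T (fun a b => tens TF (D a) (mirror_exp M D b)).

Definition product_state : T -> R[i] := Delta_state \o product_exp.

Definition product_dyn : T -> T :=
  tens_lift T (fun a b => tens T (sys_dyn S a) (commutant_dyn U b)).

Context (G : gns_triple product_state).

Definition gns_gamma (t : T) : gns_space G := gns_rep G t (gns_vec G).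

Definition implements_product_dyn (W : gns_space G -> gns_space G) : Prop :=
  unitary W /\ forall t, W (gns_gamma t) = gns_gamma (product_dyn t).

Definition gns_sub : set (gns_space G) :=
  closure [set gns_gamma (tens T f id) | f in F].

Definition relatively_ergodic (W : gns_space G -> gns_space G) : Prop :=
  [set x | W x = x] `<=` gns_sub.

End RelativeProduct.
Arguments product_state {R S M F} D T TF _.

(* Main.v *)
Require Import Defs.
From HB Require Import structures.
From mathcomp Require Import all_boot all_order all_algebra.
From mathcomp Require Import all_classical all_reals all_analysis.
From mathcomp Require Import complex ring lra.
Import Order.TTheory GRing.Theory Num.Theory.
Import numFieldNormedType.Exports.

(** Let j(a) = J (adj a) J.  Everything rests on one computation: for a, a', c, c'
    in A, the trace property gives

      < gamma(a' (x) j(c')), W^n gamma(a (x) j(c)) >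
         = mu( D(adj a' alpha^n(a)) D(alpha^n(c) adj c') ),

    so that the correlations of the relative product under W are expressed in A
    ([gns_correlation]).

    Making sense of the left-hand side requires the modular theory of a trace.
    The map a Omega |-> (adj a) Omega is then antiunitary, which forces the
    positive part of its polar decomposition to be the identity
    ([sqrt_Delta_trivial]).  Hence J a Omega = (adj a) Omega, j(a) is the right
    multiplication by a, and j exchanges A and its commutant
    ([mirror_commutant], [mirror_of_commutant]); in particular every element of
    A (x) A' is a combination of tensors a (x) j(c).

    Suppose that the relative product is ergodic relative to F, and let
    D(a) = D(b) = 0.  The formula above shows that mu(|D(b alpha^n(a))|^2) is
    the correlation of u = gamma(adj b (x) j(b)) with W^n gamma(a (x) j(adj a)).
    The vector u is orthogonal to H_lambda, hence to all fixed points of W, and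
    the correlations tend to zero in the Cesaro sense by the mean ergodic
    theorem ([mean_ergodic]).

    Conversely, let A be weakly mixing relative to F.  If D(a) = 0 or D(c) = 0,
    one factor of the correlation tends to zero in quadratic mean while the
    other is bounded, so that the correlations of gamma(a (x) j(c)) with all
    elementary tensors, and then by density with all vectors, tend to zero in
    the Cesaro sense.  Correlations with a fixed point are constant, hence zero:
    fixed points are orthogonal to all such gamma(a (x) j(c))
    ([fixed_orthogonal]).  Splitting a and c by D, what remains of a general
    gamma(a (x) j(c)) is gamma(D(a) (x) j(D(c))), and this vector is
    gamma(D(a) D(c) (x) 1) by the trace property ([gns_tens_subalgebra]), an
    element of H_lambda.  Hence the component of a fixed point orthogonal to
    H_lambda is orthogonal to everything. *)

Set Implicit Arguments.
Unset Strict Implicit.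
Unset Printing Implicit Defensive.

Local Open Scope classical_set_scope.
Local Open Scope ring_scope.

(** * Inner products and closed subspaces *)

Section Inner.
Context {R : realType} {H : hilbertType R}.
Implicit Types (x y z u v w : H) (k : R[i]).

Lemma innerDr x y z : inner x (y + z) = inner x y + inner x z.
Proof. by rewrite -[y]scale1r inner_linear mul1r scale1r. Qed.

Lemma innerr0 x : inner x 0 = 0.
Proof. by apply: (addrI (inner x 0)); rewrite -innerDr !addr0. Qed.

Lemma innerZr x k y : inner x (k *: y) = k * inner x y.
Proof. by rewrite -[k *: y]addr0 inner_linear innerr0 addr0. Qed.

Lemma innerNr x y : inner x (- y) = - inner x y.
Proof. by rewrite -scaleN1r innerZr mulN1r. Qed.

Lemma innerBr x y z : inner x (y - z) = inner x y - inner x z.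
Proof. by rewrite innerDr innerNr. Qed.

Lemma inner_conjK x y : (inner x y)^* = inner y x.
Proof. by rewrite [RHS]inner_conj. Qed.

Lemma innerDl x y z : inner (x + y) z = inner x z + inner y z.
Proof. by rewrite inner_conj innerDr rmorphD /= !inner_conjK. Qed.

Lemma inner0l x : inner 0 x = 0.
Proof. by rewrite inner_conj innerr0 rmorph0. Qed.

Lemma innerZl k x y : inner (k *: x) y = k^* * inner x y.
Proof. by rewrite inner_conj innerZr rmorphM /= inner_conjK. Qed.

Lemma innerNl x y : inner (- x) y = - inner x y.
Proof. by rewrite inner_conj innerNr rmorphN /= inner_conjK. Qed.

Lemma innerBl x y z : inner (x - y) z = inner x z - inner y z.
Proof. by rewrite innerDl innerNl. Qed.

Lemma inner_eq0 x : inner x x = 0 -> x = 0.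
Proof. by rewrite inner_norm => /eqP; rewrite sqrf_eq0 normr_eq0 => /eqP. Qed.

Lemma inner_inj x y : (forall z, inner z x = inner z y) -> x = y.
Proof.
by move=> e; apply/subr0_eq/inner_eq0; rewrite innerBr e subrr.
Qed.

(** Expanding <x - y, x - y> gives zero: vectors are often identified this way
    below, by computing three inner products. *)
Lemma inner_eq x y : inner x x = inner x y -> inner y y = inner x y -> x = y.
Proof.
move=> e1 e2; apply/subr0_eq/inner_eq0.
have e3 : inner y x = inner x y by rewrite inner_conj -e1 inner_conjK.
by rewrite innerBr !innerBl e1 e2 e3 !subrr.
Qed.

(** The vector subtracted from y is its component along x, so this is the theorem
    of Pythagoras.  Its positivity is the Cauchy-Schwarz inequality; in the
    projection theorem it measures how much a single correction along x brings
    y closer to a subspace containing x. *)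
Lemma inner_residual x y : x != 0 ->
  `|y - (inner x y / `|x| ^+ 2) *: x| ^+ 2 =
  `|y| ^+ 2 - `|inner x y| ^+ 2 / `|x| ^+ 2.
Proof.
move=> x0; have n0 : `|x| ^+ 2 != 0 by rewrite sqrf_eq0 normr_eq0.
rewrite -!inner_norm innerBr !innerBl !innerZl !innerZr inner_norm in n0 *.
rewrite inner_norm [inner y x]inner_conj normCK.
rewrite [(_ / _)^*]rmorphM /= fmorphV rmorphXn /= (conj_Creal (normr_real x)).
move: (`|x| ^+ 2) n0 (`|y| ^+ 2) (inner x y) => n n0 m c.
by move: (c^* : R[i]) => d; field.
Qed.

Lemma cauchy_schwarz x y : `|inner x y| <= `|x| * `|y|.
Proof.
have [->|x0] := eqVneq x 0; first by rewrite inner0l !normr0 mul0r.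
have n0 : 0 < `|x| ^+ 2 by rewrite exprn_gt0 ?normr_gt0.
have := exprn_ge0 2 (normr_ge0 (y - (inner x y / `|x| ^+ 2) *: x)).
rewrite inner_residual// subr_ge0 ler_pdivrMr// -exprMn mulrC.
by rewrite ler_pXn2r// ?nnegrE// mulr_ge0.
Qed.

Lemma parallelogram x y :
  `|x + y| ^+ 2 + `|x - y| ^+ 2 = (`|x| ^+ 2 + `|y| ^+ 2) *+ 2.
Proof.
rewrite -!inner_norm innerBr innerDr !innerBl !innerDl.
move: (inner x x) (inner x y) (inner y x) (inner y y) => a b c d; ring.
Qed.

Lemma norm_inner_eq x y : inner x x = inner y y -> `|x| = `|y|.
Proof.
rewrite !inner_norm => e; apply/eqP.
by rewrite -(@eqrXn2 _ 2)// e.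
Qed.

End Inner.

Section Closure.
Context {R : realType} {V : normedModType R[i]}.
Implicit Types (E : set V) (x y : V).

Lemma closure_normP E x :
  closure E x <-> forall e : R[i], 0 < e -> exists2 y, E y & `|x - y| < e.
Proof.
split=> [cx e e0|h B].
  have [y [Ey]] := cx _ (nbhsx_ballx x e e0).
  by rewrite -ball_normE /=; exists y.
rewrite -nbhs_ballE => -[e /= e0 sB]; have [y Ey xy] := h _ e0.
by exists y; split => //; apply: sB; rewrite -ball_normE.
Qed.

Lemma closureK E : closure (closure E) = closure E.
Proof. by apply/esym/closure_id; exact: closed_closure. Qed.

Definition subspace_set E : Prop :=
  E 0 /\ forall (k : R[i]) x y, E x -> E y -> E (k *: x + y).

Lemma subspace_setI E x0 : E x0 ->
  (forall (k : R[i]) x y, E x -> E y -> E (k *: x + y)) -> subspace_set E.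
Proof.
by move=> E0 Ek; split => //; rewrite -(addNr x0) -scaleN1r; exact: Ek.
Qed.

Lemma closure_subspace E : subspace_set E -> subspace_set (closure E).
Proof.
move=> [E0 Ek]; split; first exact: subset_closure.
move=> k x y /closure_normP cx /closure_normP cy; apply/closure_normP => e e0.
have k1 : 0 < `|k| + 1 by rewrite ltr_wpDl.
have e2 : 0 < e / 2 by rewrite divr_gt0.
have [x' Ex' xx'] := cx _ (divr_gt0 e2 k1).
have [y' Ey' yy'] := cy _ e2.
exists (k *: x' + y'); first exact: Ek.
rewrite opprD addrACA -scalerBr (le_lt_trans (ler_normD _ _))// normrZ.
have le1 : `|k| * `|x - x'| <= (`|k| + 1) * `|x - x'|.
  by rewrite ler_wpM2r// lerDl.
by rewrite [e]splitr ler_ltD// (le_trans le1)// mulrC -ler_pdivlMr// ltW.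
Qed.

End Closure.

(** * Orthogonal projections *)

Section Eps.
Context {R : realType} {V : normedModType R[i]}.

Lemma norm_lt_eps_eq0 (z : V) : (forall e : R[i], 0 < e -> `|z| < e) -> z = 0.
Proof.
move=> h; apply/eqP; apply: contraT => z0.
have := h `|z|; rewrite normr_gt0 => /(_ z0).
by rewrite ltxx.
Qed.

Lemma complex_gt0P (e : R[i]) : 0 < e -> exists2 r : R, 0 < r & e = (r%:C)%C.
Proof.
move=> e0; exists (complex.Re e); last by rewrite RRe_real ?gtr0_real.
by move: e0; rewrite ltcE => /andP[].
Qed.

End Eps.

Section Projection.
Context {R : realType} {H : hilbertType R}.
Implicit Types (x y z u v w : H) (k : R[i]) (E : set H).

(** A minimizing sequence is Cauchy by the parallelogram identity.  Its residuals
    become orthogonal to E, because no correction along a vector of E brings x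
    closer than the infimum of the distances. *)
Lemma projection_theorem E x : subspace_set E -> closure E `<=` E ->
  exists2 v, E v & forall w, E w -> inner w (x - v) = 0.
Proof.
move=> [E0 Ek] Ecl.
pose N v : R := complex.Re (`|x - v| ^+ 2).
have NE v : ((N v)%:C)%C = `|x - v| ^+ 2.
  by rewrite RRe_real// ger0_real// exprn_ge0.
have N_ge0 v : 0 <= N v by rewrite -ler0c NE exprn_ge0.
have hi : has_inf [set N v | v in E].
  by split; [exists (N 0), 0 | exists 0 => _ [v _ <-]].
pose d := inf [set N v | v in E].
have dN v : E v -> d <= N v.
  by move=> Ev; apply: ge_inf; [case: hi | exists v].
have ex n : exists v, E v /\ N v < d + n.+1%:R^-1.
  have [|_ [v Ev <-] h] := @inf_adherent _ _ n.+1%:R^-1 _ hi; first by [].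
  by exists v.
have {ex}[vs vsP] := choice ex.
have Evs n : E (vs n) by case: (vsP n).
(* the parallelogram identity turns almost minimal distance into closeness *)
have dist u v r : E u -> E v -> N u < d + r -> N v < d + r ->
    `|u - v| ^+ 2 < ((4 * r)%:C)%C.
  move=> Eu Ev Nu Nv.
  have Em : E (2^-1 *: u + 2^-1 *: v).
    by apply: (Ek) => //; rewrite -[_ *: v]addr0; exact: Ek.
  have e1 : (x - u) + (x - v) = 2 *: (x - (2^-1 *: u + 2^-1 *: v)).
    rewrite scalerBr scalerDr !scalerA mulfV// !scale1r scaler_nat mulr2n.
    by rewrite opprD addrACA.
  have e2 : (x - u) - (x - v) = v - u by rewrite opprB addrC addrA subrK.
  have := parallelogram (x - u) (x - v).
  rewrite e1 e2 normrZ exprMn -!NE distrC normr_nat -rmorphD -rmorphMn /=.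
  move=> /(canRL (addKr _)) ->.
  have := dN _ Em; move: (N _) (N u) (N v) Nu Nv => m a b am bm dm.
  rewrite -natrX -[(_ ^ _)%:R](rmorph_nat (real_complex R)) -rmorphM -rmorphN.
  rewrite -rmorphD ltcR; lra.
have vs_cvg : cvg (vs @ \oo).
  apply/cauchy_cvgP/cauchy_exP => _ /complex_gt0P[r r0 ->].
  have : (fun n => n.+1%:R^-1 : R) @ \oo --> 0 by exact: cvg_harmonic.
  have r4 : 0 < r ^+ 2 / 4 by rewrite divr_gt0// exprn_gt0.
  move=> /cvgr0Pnorm_lt /(_ _ r4) [n _ hn].
  exists (vs n), n => // m /= nm.
  rewrite -ball_normE /= -(@ltr_pXn2r _ 2)// ?nnegrE// ?ler0c ?ltW//.
  have h p : (n <= p)%N -> N (vs p) < d + r ^+ 2 / 4.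
    move=> np; have [_ /lt_le_trans-> //] := vsP p; rewrite lerD2l ltW//.
    by have := hn _ np; rewrite /= ger0_norm.
  have := dist _ _ _ (Evs n) (Evs m) (h _ (leqnn n)) (h _ nm).
  by rewrite -rmorphXn /= mulrC divfK.
pose v := lim (vs @ \oo).
have near_v e : 0 < e -> \forall n \near \oo, `|v - vs n| < e.
  by move=> e0; apply: cvgr_dist_lt => //; exact: vs_cvg.
exists v.
  apply/Ecl/closure_normP => e /near_v [n _ hn].
  by exists (vs n) => //; apply: (hn n) => /=.
move=> w Ew; have [->|w0] := eqVneq w 0; first by rewrite inner0l.
have nw : 0 < `|w| by rewrite normr_gt0.
apply: (@norm_lt_eps_eq0 _ R[i]^o) => e e0.
have e2 : 0 < e / 2 by rewrite divr_gt0.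
have [n1 _ h1] := near_v _ (divr_gt0 e2 nw).
have [r r0 er] := complex_gt0P (divr_gt0 e2 nw).
have : (fun n => n.+1%:R^-1 : R) @ \oo --> 0 by exact: cvg_harmonic.
have r2 : 0 < r ^+ 2 by rewrite exprn_gt0.
move=> /cvgr0Pnorm_lt /(_ _ r2) [n2 _ h2].
pose n := maxn n1 n2.
have -> : x - v = (x - vs n) - (v - vs n).
  by rewrite opprB addrC addrA subrK addrC.
rewrite innerBr (le_lt_trans (ler_normB _ _))// [e]splitr ler_ltD//; last first.
  rewrite (le_lt_trans (cauchy_schwarz _ _))// mulrC -ltr_pdivlMr//.
  by apply: h1; rewrite /= leq_maxl.
(* correcting vs n by the component of its residual along w cannot beat d *)
have := NE (vs n + (inner w (x - vs n) / `|w| ^+ 2) *: w).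
rewrite opprD addrA inner_residual// => e1.
have : (d%:C)%C <= `|x - vs n| ^+ 2 - `|inner w (x - vs n)| ^+ 2 / `|w| ^+ 2.
  by rewrite -e1 lecR dN// addrC; exact: Ek.
rewrite -NE lerBrDl -lerBrDr => h3.
rewrite -(@ler_pM2r _ `|w|^-1) ?invr_gt0// er.
rewrite -(@ler_pXn2r _ 2)// ?nnegrE ?divr_ge0//; last first.
  by rewrite ler0c ltW.
rewrite expr_div_n (le_trans h3)// -rmorphXn -rmorphB lecR lerBlDl.
have [_ /ltW/le_trans-> //] := vsP n; rewrite lerD2l ltW//.
have := h2 n; rewrite /= ger0_norm//; apply; exact: leq_maxr.
Qed.

Lemma subspace_orthogonal (h : H) : subspace_set [set y | inner y h = 0].
Proof.
split=> [|k x y]; rewrite /= ?inner0l// => hx hy.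
by rewrite innerDl innerZl hx hy mulr0 addr0.
Qed.

Lemma closure_orthogonal E (h : H) :
  (forall y, E y -> inner y h = 0) -> forall x, closure E x -> inner x h = 0.
Proof.
move=> Eh x /closure_normP cx; apply: (@norm_lt_eps_eq0 _ R[i]^o) => e e0.
have C1 : 0 < `|h| + 1 by rewrite ltr_wpDl.
have [y Ey xy] := cx _ (divr_gt0 e0 C1).
have -> : inner x h = inner (x - y) h by rewrite innerBl (Eh y)// subr0.
rewrite (le_lt_trans (cauchy_schwarz _ _))//.
rewrite (le_lt_trans (y := `|x - y| * (`|h| + 1)))//.
  by rewrite ler_wpM2l// lerDl.
by rewrite -ltr_pdivlMr.
Qed.

End Projection.

(** * Adjoints and von Neumann algebras *)

Section Bounded.
Context {R : realType} {H : hilbertType R}.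
Implicit Types (x y z : H) (a b c : H -> H).

Lemma op_bound a : bounded_op a ->
  exists2 C : R[i], 0 < C & forall x, `|a x| <= C * `|x|.
Proof.
move=> [la ca].
pose f : {linear H -> H} := HB.pack a (GRing.isLinear.Build _ _ _ _ a la).
have /linear_boundedP /pinfty_ex_gt0 [C C0 hC] : bounded_near f (nbhs (0 : H)).
  exact/linear_bounded_continuous.
by exists C.
Qed.

Lemma bounded_opI a (C : R[i]) : linear a -> (forall x, `|a x| <= C * `|x|) ->
  bounded_op a.
Proof.
move=> la hC; split => //.
pose f : {linear H -> H} := HB.pack a (GRing.isLinear.Build _ _ _ _ a la).
(* C may be negative if the space is trivial *)
have C_ge0 x : `|a x| <= (`|C| + 1) * `|x|.
  have [->|x0] := eqVneq x 0.
    have -> : a 0 = 0 by exact: (linear0 f).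
    by rewrite !normr0 mulr0.
  have n0 : 0 < `|x| by rewrite normr_gt0.
  have Creal : 0 <= C by rewrite -(pmulr_lge0 _ n0) (le_trans _ (hC x)).
  by rewrite (le_trans (hC x))// ler_wpM2r// ger0_norm// lerDl.
apply: (@bounded_linear_continuous _ _ _ f).
by apply/bounded_funP => r; exists ((`|C| + 1) * r) => x xr;
  rewrite (le_trans (C_ge0 x))// ler_wpM2l// addr_ge0.
Qed.

Section LinearOp.
Context (a : H -> H) (la : bounded_op a).

Lemma opP k x y : a (k *: x + y) = k *: a x + a y. Proof. exact: la.1. Qed.
Lemma op0 : a 0 = 0.
Proof. by apply: (addrI (a 0)); rewrite -{1}[a 0]scale1r -opP scaler0 !addr0. Qed.
Lemma opZ k x : a (k *: x) = k *: a x.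
Proof. by rewrite -[k *: x]addr0 opP op0 addr0. Qed.
Lemma opD x y : a (x + y) = a x + a y.
Proof. by rewrite -[x]scale1r opP !scale1r. Qed.
Lemma opB x y : a (x - y) = a x - a y.
Proof. by rewrite opD -scaleN1r opZ scaleN1r. Qed.
End LinearOp.

Lemma bounded_op_id : bounded_op (id : H -> H).
Proof. by apply: (@bounded_opI _ 1) => [k x y|x]; rewrite ?mul1r. Qed.

Lemma bounded_op_comp a b : bounded_op a -> bounded_op b -> bounded_op (a \o b).
Proof.
move=> ba bb; have [C C0 hC] := op_bound ba; have [D D0 hD] := op_bound bb.
apply: (@bounded_opI _ (C * D)) => [k x y|x] /=.
  by rewrite (opP bb) (opP ba).
by rewrite (le_trans (hC _))// -mulrA ler_wpM2l// ltW.
Qed.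

Lemma lin_fctE k a b x : (k *: a + b) x = k *: a x + b x.
Proof. by []. Qed.

Lemma bounded_op_lin k a b : bounded_op a -> bounded_op b ->
  bounded_op (k *: a + b).
Proof.
move=> ba bb; have [C C0 hC] := op_bound ba; have [D D0 hD] := op_bound bb.
apply: (@bounded_opI _ (`|k| * C + D)) => [l x y|x] /=.
  rewrite !lin_fctE (opP ba) (opP bb) !scalerDr !scalerA !addrA.
  rewrite [k * l]mulrC; congr (_ + _).
  by rewrite addrAC.
rewrite lin_fctE (le_trans (ler_normD _ _))// mulrDl lerD// normrZ -mulrA.
by rewrite ler_wpM2l.
Qed.

(** A vector orthogonal to the kernel of phi, which is closed, represents phi up
    to a scalar. *)
Lemma riesz (phi : H -> R[i]) (C : R[i]) :
  (forall k x y, phi (k *: x + y) = k * phi x + phi y) ->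
  (forall x, `|phi x| <= C * `|x|) ->
  exists z, forall x, phi x = inner z x.
Proof.
move=> lin bd.
have phi0 : phi 0 = 0.
  by apply: (addrI (phi 0)); rewrite -{1}[phi 0]mul1r -lin scale1r !addr0.
have phiB x y : phi (x - y) = phi x - phi y.
  by rewrite addrC -scaleN1r lin mulN1r addrC.
pose E := [set x | phi x = 0].
have Es : subspace_set E.
  by split=> [//|k x y] /= px py; rewrite /E/= lin px py mulr0 addr0.
have Ecl : closure E `<=` E.
  move=> x /closure_normP cx; apply: (@norm_lt_eps_eq0 _ R[i]^o) => e e0.
  have C1 : 0 < `|C| + 1 by rewrite ltr_wpDl.
  have [y /= py xy] := cx _ (divr_gt0 e0 C1).
  have -> : phi x = phi (x - y) by rewrite phiB py subr0.
  have [->|xy0] := eqVneq (x - y) 0; first by rewrite phi0 normr0.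
  have n0 : 0 < `|x - y| by rewrite normr_gt0.
  have Creal : 0 <= C by rewrite -(pmulr_lge0 _ n0) (le_trans _ (bd _)).
  rewrite (le_lt_trans (bd _))// (le_lt_trans (y := (`|C| + 1) * `|x - y|))//.
    by rewrite ler_wpM2r// ger0_norm// lerDl.
  by rewrite mulrC -ltr_pdivlMr.
have [h|/existsNP[x /eqP px]] := pselect (forall x, phi x = 0).
  by exists 0 => x; rewrite inner0l.
have [v Ev vP] := projection_theorem x Es Ecl.
set h := x - v in vP.
have ph : phi h != 0 by rewrite phiB Ev subr0.
have h0 : inner h h != 0.
  by apply: contraNneq ph => /inner_eq0 ->; rewrite phi0.
exists ((phi h / inner h h)^* *: h) => y.
have Ey : E (- (phi y / phi h) *: h + y).
  by rewrite /E/= lin mulNr divfK// addNr.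
have := vP _ Ey.
rewrite inner_conj innerDr innerZr mulNr => /eqP.
rewrite fmorph_eq0 addrC subr_eq0 => /eqP e.
rewrite innerZl conjCK e; move: (inner h h) (phi h) h0 ph => p q p0 q0.
by field; rewrite p0 q0.
Qed.

Lemma adj_exists a : bounded_op a ->
  exists b : H -> H, forall x y, inner (a x) y = inner x (b y).
Proof.
move=> ba; have [C C0 hC] := op_bound ba.
suff ex y : exists z, forall x, inner (a x) y = inner x z.
  by have [b hb] := choice ex; exists b.
have [z hz] : exists z, forall x, inner y (a x) = inner z x.
  apply: (@riesz _ (`|y| * C)) => [k u v|x].
    by rewrite opP// innerDr innerZr.
  by rewrite (le_trans (cauchy_schwarz _ _))// -mulrA ler_wpM2l.
by exists z => x; rewrite inner_conj hz inner_conjK.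
Qed.

Lemma adjP a : bounded_op a -> forall x y, inner (a x) y = inner x (adj a y).
Proof.
move=> /adj_exists [b hb]; exact: (@getPex _ [set b | forall x y,
  inner (a x) y = inner x (b y)] (ex_intro _ b hb)).
Qed.

Lemma adj_unique a b : bounded_op a ->
  (forall x y, inner (a x) y = inner x (b y)) -> adj a = b.
Proof.
move=> ba hb; apply/funext => y; apply: inner_inj => x.
by rewrite -adjP// hb.
Qed.

Lemma adjPr a : bounded_op a -> forall x y, inner (adj a x) y = inner x (a y).
Proof. by move=> ba x y; rewrite inner_conj -adjP// inner_conjK. Qed.

Lemma adj_bounded a : bounded_op a -> bounded_op (adj a).
Proof.
move=> ba; have [C C0 hC] := op_bound ba.
apply: (@bounded_opI _ C) => [k x y|y].
  by apply: inner_inj => z; rewrite innerDr innerZr -!adjP// innerDr innerZr.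
have [->|n0] := eqVneq (adj a y) 0; first by rewrite normr0 mulr_ge0// ltW.
have n1 : 0 < `|adj a y| by rewrite normr_gt0.
rewrite -(ler_pM2l n1) -expr2 -inner_norm -adjP// -[leLHS]ger0_norm.
  rewrite (le_trans (cauchy_schwarz _ _))// mulrCA mulrA.
  by rewrite ler_wpM2r.
by rewrite adjP// inner_norm exprn_ge0.
Qed.

Lemma adjK a : bounded_op a -> adj (adj a) = a.
Proof.
move=> ba; apply: adj_unique; first exact: adj_bounded.
by move=> x y; rewrite adjPr.
Qed.

Lemma adj_id : adj (id : H -> H) = id.
Proof. by apply: adj_unique => //; exact: bounded_op_id. Qed.

Lemma adj_comp a b : bounded_op a -> bounded_op b ->
  adj (a \o b) = adj b \o adj a.
Proof.
move=> ba bb; apply: adj_unique; first exact: bounded_op_comp.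
by move=> x y /=; rewrite !adjP.
Qed.

Lemma adj_lin k a b : bounded_op a -> bounded_op b ->
  adj (k *: a + b) = k^* *: adj a + adj b.
Proof.
move=> ba bb; apply: adj_unique; first exact: bounded_op_lin.
by move=> x y; rewrite !lin_fctE innerDl innerZl innerDr innerZr !adjP.
Qed.

End Bounded.

Section VonNeumann.
Context {R : realType} {H : hilbertType R}.
Implicit Types (a b : H -> H) (A S : set (H -> H)).

Lemma commutant_id S : commutant S id.
Proof. by split; first exact: bounded_op_id. Qed.

Lemma commutant_comp S a b : commutant S a -> commutant S b ->
  commutant S (a \o b).
Proof.
move=> [ba ca] [bb cb]; split; first exact: bounded_op_comp.
by move=> c Sc; rewrite compA ca// -compA cb// compA.
Qed.

Lemma commutant_lin S k a b : S `<=` bounded_op ->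
  commutant S a -> commutant S b -> commutant S (k *: a + b).
Proof.
move=> SB [ba ca] [bb cb]; split; first exact: bounded_op_lin.
move=> c Sc; apply/funext => x; have bc := SB _ Sc.
have /(congr1 (@^~ x)) /= e1 := ca _ Sc; have /(congr1 (@^~ x)) /= e2 := cb _ Sc.
by rewrite /= !lin_fctE opP// e1 e2.
Qed.

Lemma commutant_adj S a : S `<=` bounded_op -> (forall b, S b -> S (adj b)) ->
  commutant S a -> commutant S (adj a).
Proof.
move=> SB Sadj [ba ca]; split; first exact: adj_bounded.
move=> c Sc; have bc := SB _ Sc.
by rewrite -[c](adjK bc) -!adj_comp ?ca//; [apply: Sadj|exact: adj_bounded..].
Qed.

Lemma commutant_bounded S : commutant S `<=` bounded_op.
Proof. by move=> a []. Qed.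

Section Closure.
Context A (vA : von_neumann A).

Lemma vn_bounded a : A a -> bounded_op a. Proof. by case: vA => + _ _; apply. Qed.
Lemma vn_adj a : A a -> A (adj a). Proof. by case: vA => _ + _; apply. Qed.
Lemma vn_id : A id.
Proof. by case: vA => _ _ <-; exact: commutant_id. Qed.
Lemma vn_comp a b : A a -> A b -> A (a \o b).
Proof. by case: vA => _ _ <-; exact: commutant_comp. Qed.
Lemma vn_lin k a b : A a -> A b -> A (k *: a + b).
Proof.
by case: vA => _ _ <-; apply: commutant_lin; exact: commutant_bounded.
Qed.
Lemma vnB a b : A a -> A b -> A (a - b).
Proof. by move=> Aa Ab; rewrite addrC -scaleN1r; exact: vn_lin. Qed.

Lemma vn_commutant : von_neumann (commutant A).
Proof.
have [AB AA Ac] := vA; split; last by rewrite Ac.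
- exact: commutant_bounded.
- by move=> a; exact: commutant_adj.
Qed.

End Closure.
End VonNeumann.

(** * Cesaro means and the mean ergodic theorem *)

Section Cesaro.
Context {R : realType}.
Implicit Types (u v : nat -> R[i]) (d : nat -> R[i]).

Definition cesaro u (N : nat) : R[i] := N%:R^-1 * \sum_(1 <= n < N.+1) u n.

Definition cesaro0 u : Prop :=
  (cesaro u : nat -> R[i]^o) @ \oo --> (0 : R[i]^o).

Lemma cesaro0P u : cesaro0 u <->
  forall e, 0 < e -> exists n, forall N, (n <= N)%N -> `|cesaro u N| <= e.
Proof.
split=> [/(@cvgr0_norm_le _ _ _ _ _ _) h e e0|h].
  by have [n _ hn] := h _ e0; exists n => N nN; exact: hn.
apply/(@cvgr0Pnorm_lt _ R[i]^o) => e e0.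
have [n hn] := h _ (divr_gt0 e0 (@ltr0Sn _ 1)).
exists n => // N nN; rewrite /= (le_lt_trans (hn N nN))//.
by rewrite ltr_pdivrMr// ltr_pMr// ltr1n.
Qed.

Lemma cesaro_lin k u v N :
  cesaro (fun n => k * u n + v n) N = k * cesaro u N + cesaro v N.
Proof. by rewrite /cesaro big_split -mulr_sumr mulrDr /= mulrCA. Qed.

Lemma eq_cesaro u v : u =1 v -> cesaro u = cesaro v.
Proof. by move=> /funext ->. Qed.

Lemma cesaro_cst k N : cesaro (fun=> k) N.+1 = k.
Proof.
rewrite /cesaro sumr_const_nat subn1 /= -[k *+ _]mulr_natl mulrA.
by rewrite mulVf ?mul1r// pnatr_eq0.
Qed.

Lemma norm_cesaro_le u d : (forall n, `|u n| <= d n) ->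
  forall N, `|cesaro u N| <= cesaro d N.
Proof.
move=> ud N; rewrite /cesaro normrM ger0_norm ?invr_ge0//.
rewrite ler_wpM2l ?invr_ge0// (le_trans (ler_norm_sum _ _ _))//.
exact: ler_sum.
Qed.

Lemma cesaro_cst_le k N : 0 <= k -> cesaro (fun=> k) N <= k.
Proof.
by case: N => [|N] k0; rewrite ?cesaro_cst// /cesaro big_geq// mulr0.
Qed.

Lemma norm_cesaro_cst u C : (forall n, `|u n| <= C) ->
  forall N, `|cesaro u N| <= C.
Proof.
move=> uC N; rewrite (le_trans (norm_cesaro_le uC _))// cesaro_cst_le//.
exact: le_trans (uC 0%N).
Qed.

Lemma cesaro0_lin k u v : cesaro0 u -> cesaro0 v ->
  cesaro0 (fun n => k * u n + v n).
Proof.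
move=> /cesaro0P hu /cesaro0P hv; apply/cesaro0P => e e0.
have e2 : 0 < e / 2 by rewrite divr_gt0.
have k1 : 0 < `|k| + 1 by rewrite ltr_wpDl.
have [n hn] := hu _ (divr_gt0 e2 k1); have [m hm] := hv _ e2.
exists (maxn n m) => N; rewrite geq_max => /andP[nN mN].
rewrite cesaro_lin (le_trans (ler_normD _ _))// [e]splitr lerD ?hm// normrM.
rewrite (le_trans (y := (`|k| + 1) * `|cesaro u N|))//.
  by rewrite ler_wpM2r// lerDl.
by rewrite mulrC -ler_pdivlMr// hn.
Qed.

Lemma cesaro0_conj u : cesaro0 u -> cesaro0 (fun n => (u n)^*).
Proof.
move=> /cesaro0P h; apply/cesaro0P => e /h [n hn]; exists n => N /hn.
suff -> : cesaro (fun n => (u n)^*) N = (cesaro u N)^* by rewrite norm_conjC.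
by rewrite /cesaro rmorphM fmorphV rmorph_nat rmorph_sum.
Qed.

Lemma cesaro0_cst k : cesaro0 (fun=> k) -> k = 0.
Proof.
move=> /cesaro0P h; apply: (@norm_lt_eps_eq0 _ R[i]^o) => e e0.
have [n hn] := h _ (divr_gt0 e0 (@ltr0Sn _ 1)).
have := hn n.+1 (leqnSn n); rewrite cesaro_cst => /le_lt_trans; apply.
by rewrite ltr_pdivrMr// ltr_pMr// ltr1n.
Qed.

(** By the inequality between the arithmetic and the geometric mean,
    C d <= e/2 + C^2 d^2 / (2 e) for every e > 0, so that quadratic Cesaro
    convergence to zero forces Cesaro convergence of anything that d
    dominates. *)
Lemma cesaro0_dominated u d C : 0 < C -> (forall n, 0 <= d n) ->
  (forall n, `|u n| <= C * d n) -> cesaro0 (fun n => d n ^+ 2) -> cesaro0 u.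
Proof.
move=> C0 d0 ud /cesaro0P h; apply/cesaro0P => e e0.
have e2 : 0 < e / 2 by rewrite divr_gt0.
have c2 : 0 < C ^+ 2 / (2 * e) by rewrite divr_gt0 ?exprn_gt0 ?mulr_gt0.
have [n hn] := h _ (divr_gt0 e2 c2).
exists n => N nN.
have ub m : `|u m| <= C ^+ 2 / (2 * e) * d m ^+ 2 + e / 2.
  rewrite (le_trans (ud m))// -subr_ge0.
  have -> : C ^+ 2 / (2 * e) * d m ^+ 2 + e / 2 - C * d m =
            (C * d m - e) ^+ 2 / (2 * e).
    by field; rewrite gt_eqF.
  have ee : 0 <= 2 * e by rewrite mulr_ge0// ltW.
  rewrite divr_ge0// -realEsqr realB// ?ger0_real// ?mulr_ge0//; exact: ltW.
rewrite (le_trans (norm_cesaro_le ub _))// cesaro_lin [leRHS]splitr.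
rewrite lerD ?cesaro_cst_le ?(ltW e2)// -ler_pdivlMl// mulrC.
have := hn _ nN; rewrite ger0_norm// mulr_ge0 ?invr_ge0// sumr_ge0// => i _.
exact: exprn_ge0.
Qed.

Lemma cesaro0_telescope u (z : nat -> R[i]) C : (forall n, `|z n| <= C) ->
  (forall n, u n.+1 = z n.+1 - z n) -> cesaro0 u.
Proof.
move=> zC uz; apply/cesaro0P => e e0.
have [r r0 er] := complex_gt0P e0.
have [c c0 Cc] : exists2 c : R, 0 <= c & C = (c%:C)%C.
  have C0 : 0 <= C by exact: le_trans (zC 0%N).
  exists (complex.Re C); last by rewrite RRe_real ?ger0_real.
  by move: C0; rewrite lecE => /andP[].
have : (fun n => n.+1%:R^-1 : R) @ \oo --> 0 by exact: cvg_harmonic.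
have c1 : 0 < 2 * c + 1 by lra.
move=> /cvgr0Pnorm_lt /(_ _ (divr_gt0 r0 c1)) [n _ hn].
exists n.+1 => -[//|N]; rewrite ltnS => nN.
rewrite /cesaro big_add1 /= (eq_bigr _ (fun n _ => uz n)).
rewrite telescope_sumr// normrM ger0_norm ?invr_ge0//.
have zz : `|z N.+1 - z 0%N| <= ((2 * c + 1)%:C)%C.
  rewrite (le_trans (ler_normB _ _))// (le_trans (lerD (zC _) (zC _)))// Cc.
  by rewrite -rmorphD lecR; lra.
rewrite (le_trans (ler_wpM2l _ zz)) ?invr_ge0// er.
have := hn N nN; rewrite /= ger0_norm// ltr_pdivlMr// => /ltW.
by rewrite -lecR rmorphM fmorphV rmorph_nat.
Qed.

Section Averages.
Context {H : hilbertType R} (w : nat -> H) (C : R[i]).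
Hypothesis wC : forall n, `|w n| <= C.

Lemma subspace_cesaro0 : subspace_set [set v | cesaro0 (fun n => inner v (w n))].
Proof.
split=> [|k x y]; rewrite /=.
  apply/cesaro0P => e e0; exists 0%N => N _.
  under eq_cesaro do rewrite inner0l.
  by rewrite /cesaro big1// mulr0 normr0 ltW.
move=> cx cy; have := cesaro0_lin k^* cx cy.
by congr cesaro0; apply/funext => n; rewrite innerDl innerZl.
Qed.

Lemma closed_cesaro0 :
  closure [set v | cesaro0 (fun n => inner v (w n))] `<=`
  [set v | cesaro0 (fun n => inner v (w n))].
Proof.
move=> x /closure_normP cx; apply/cesaro0P => e e0.
have C0 : 0 <= C by exact: le_trans (wC 0%N).
have C1 : 0 < C + 1 by rewrite ltr_wpDl.
have e2 : 0 < e / 2 by rewrite divr_gt0.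
have [y /= /cesaro0P /(_ _ e2) [n hn] xy] := cx _ (divr_gt0 e2 C1).
exists n => N nN.
have -> : cesaro (fun n => inner x (w n)) N =
    1 * cesaro (fun n => inner (x - y) (w n)) N +
    cesaro (fun n => inner y (w n)) N.
  by rewrite -cesaro_lin; congr cesaro; apply/funext => m;
     rewrite mul1r -innerDl subrK.
rewrite mul1r (le_trans (ler_normD _ _))// [e]splitr lerD ?hn//.
apply: norm_cesaro_cst => m; rewrite (le_trans (cauchy_schwarz _ _))//.
rewrite (le_trans (ler_pM _ _ (ltW xy) (wC m)))//.
by rewrite mulrAC ler_pdivrMr// ler_wpM2l ?lerDl// ltW.
Qed.

End Averages.

Section MeanErgodic.
Context {H : hilbertType R} (W : H -> H) (uW : unitary W).

Lemma unitary_inner x y : inner (W x) (W y) = inner x y.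
Proof. by case: uW => _ + _; apply. Qed.

Lemma unitary_norm x : `|W x| = `|x|.
Proof. by apply: norm_inner_eq; rewrite unitary_inner. Qed.

Lemma unitary_bounded : bounded_op W.
Proof.
apply: (@bounded_opI _ _ _ 1); first by case: uW.
by move=> x; rewrite mul1r unitary_norm.
Qed.

Lemma unitary_iter_norm n x : `|iter n W x| = `|x|.
Proof. by elim: n => //= n IH; rewrite unitary_norm. Qed.

Lemma unitary_iter_inner n x y :
  inner (iter n W x) (iter n W y) = inner x y.
Proof. by elim: n => //= n IH; rewrite unitary_inner. Qed.

(** A vector u orthogonal to the fixed points of W lies in the closure of the
    range of W - 1, where the averages telescope. *)
Lemma mean_ergodic (u v : H) : (forall x, W x = x -> inner u x = 0) ->
  cesaro0 (fun n => inner u (iter n W v)).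
Proof.
move=> u_fix; have [lW _ _] := uW.
have W0 : W 0 = 0.
  by apply: (addrI (W 0)); rewrite -{1}[W 0]scale1r -lW scaler0 !addr0.
have Es : subspace_set (range (fun x => W x - x)).
  split; first by exists 0 => //; rewrite W0 subr0.
  move=> k _ _ [x _ <-] [y _ <-]; exists (k *: x + y) => //.
  by rewrite lW scalerBr opprD addrACA.
have cE : closure (closure (range (fun x => W x - x))) `<=`
    closure (range (fun x => W x - x)) by rewrite closureK.
have [u1 Eu1 u1P] := projection_theorem u (closure_subspace Es) cE.
set h := u - u1 in u1P.
have hW z : inner (W z) h = inner z h.
  apply/subr0_eq; rewrite -innerBl; apply: u1P; apply: subset_closure.
  by exists z.
have Wh : W h = h.
  have e1 : inner h (W h) = inner h h by rewrite inner_conj hW inner_conjK.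
  by apply/esym/inner_eq; rewrite ?unitary_inner e1.
have h0 : u = u1.
  apply/subr0_eq/inner_eq0; rewrite -/h {1}/h innerBl (u1P _ Eu1) subr0.
  exact: u_fix.
have wv n : `|iter n W v| <= `|v| by rewrite unitary_iter_norm.
apply: (closed_cesaro0 wv); rewrite h0; apply: closure_subset Eu1.
move=> _ [x _ <-] /=.
apply: (@cesaro0_telescope _ (fun n => - inner x (iter n W v)) (`|x| * `|v|)).
  by move=> n; rewrite normrN (le_trans (cauchy_schwarz _ _))// ler_wpM2l.
by move=> n; rewrite innerBl /= unitary_inner opprK addrC.
Qed.

End MeanErgodic.
End Cesaro.

(** * The modular conjugation of a trace *)

Section Dense.
Context {R : realType} {H : hilbertType R} {E : set H}.
Hypothesis dE : closure E = setT.

Lemma dense_op_ext (f g : H -> H) : bounded_op f -> bounded_op g ->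
  (forall x, E x -> f x = g x) -> f = g.
Proof.
move=> bf bg fg; apply/funext => x; apply/subr0_eq/norm_lt_eps_eq0 => e e0.
have [C C0 hC] := op_bound bf; have [D D0 hD] := op_bound bg.
have CD : 0 < C + D by rewrite addr_gt0.
have /closure_normP /(_ _ (divr_gt0 e0 CD)) [y Ey xy] : closure E x by rewrite dE.
have -> : f x - g x = f (x - y) - g (x - y).
  by rewrite (opB bf) (opB bg) (fg y Ey) opprB addrA subrK.
rewrite (le_lt_trans (ler_normB _ _))// (le_lt_trans (lerD (hC _) (hD _)))//.
by rewrite -mulrDl -ltr_pdivlMl// mulrC.
Qed.

Lemma dense_orthogonal_eq0 (x : H) : (forall y, E y -> inner y x = 0) -> x = 0.
Proof.
by move=> h; apply: inner_eq0; apply: (closure_orthogonal h); rewrite dE.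
Qed.

Lemma dense_inner_inj (x z : H) : (forall y, E y -> inner y x = inner y z) ->
  x = z.
Proof.
move=> h; apply/subr0_eq/dense_orthogonal_eq0 => y Ey.
by rewrite innerBr h// subrr.
Qed.

End Dense.

Section GraphClosure.
Context {R : realType} {H : hilbertType R}.
Implicit Types (P : set (H * H)) (u v : H).

Lemma closure_pair P p (e : R[i]) : closure P p -> 0 < e ->
  exists2 q, P q & `|p.1 - q.1| < e /\ `|p.2 - q.2| < e.
Proof.
move=> cP e0.
have [|q [Pq [/= h1 h2]]] := cP [set q | ball p.1 e q.1 /\ ball p.2 e q.2].
  exists (ball p.1 e, ball p.2 e); first by split; exact: nbhsx_ballx.
  by move=> q [].
by exists q => //; move: h1 h2; rewrite -ball_normE.
Qed.

Lemma closure_inner_eq P u v : (forall q, P q -> inner v q.2 = inner q.1 u) ->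
  forall p, closure P p -> inner v p.2 = inner p.1 u.
Proof.
move=> h p cp; apply/subr0_eq; apply: (@norm_lt_eps_eq0 _ R[i]^o) => e e0.
have C1 : 0 < `|v| + `|u| + 1 by rewrite ltr_wpDl// addr_ge0.
have [q Pq [h1 h2]] := closure_pair cp (divr_gt0 e0 C1).
have -> : inner v p.2 - inner p.1 u =
    inner v (p.2 - q.2) - inner (p.1 - q.1) u.
  by rewrite innerBr innerBl (h q Pq) opprB addrA subrK.
rewrite (le_lt_trans (ler_normB _ _))//.
rewrite (le_lt_trans (lerD (cauchy_schwarz _ _) (cauchy_schwarz _ _)))//.
rewrite (le_lt_trans (lerD (ler_wpM2l _ (ltW h2)) (ler_wpM2r _ (ltW h1))))//.
by rewrite [_ * `|u|]mulrC -mulrDl mulrA ltr_pdivrMr// mulrC ltr_pM2l// ltrDl.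
Qed.

End GraphClosure.

Section Conjugation.
Context {R : realType} {S : system R} {M : modular_data S}.
Local Notation H := (sys_space S).
Local Notation A := (sys_alg S).
Local Notation Om := (sys_vac S).
Local Notation J := (modular_conj M).
Local Notation j := (mirror M).
Implicit Types (a b c : H -> H) (x y z u v : H).

Local Notation vA := (alg_von_neumann S).
Local Notation vA' := (vn_commutant (alg_von_neumann S)).

Lemma vac_inner a b : A a -> inner (a Om) (b Om) = state S (adj a \o b).
Proof. by move=> Aa; rewrite adjP//; exact: (vn_bounded vA). Qed.

Lemma antiunitary_inner x y : inner (J x) (J y) = inner y x.
Proof. by case: (modular_antiunitary M). Qed.

Lemma antiunitary_lin (k : R[i]) x y : J (k *: x + y) = k^* *: J x + J y.
Proof. by case: (modular_antiunitary M). Qed.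

Lemma antiunitary_norm x : `|J x| = `|x|.
Proof. by apply: norm_inner_eq; rewrite antiunitary_inner. Qed.

Section Trace.
Hypothesis tr : tracial S.

Lemma trace_inner a b : A a -> A b ->
  inner (adj b Om) (adj a Om) = inner (a Om) (b Om).
Proof.
move=> Aa Ab; have [ba bb] := (vn_bounded vA Aa, vn_bounded vA Ab).
rewrite !vac_inner ?adjK//; last exact: (vn_adj vA).
by rewrite tr//; exact: (vn_adj vA).
Qed.

Lemma trace_norm a : A a -> `|adj a Om| = `|a Om|.
Proof. by move=> Aa; apply: norm_inner_eq; exact: trace_inner. Qed.

Let G := [set (a Om, adj a Om) | a in A].

Lemma closure_tomita_inner p q : closure G p -> closure G q ->
  inner q.2 p.2 = inner p.1 q.1.
Proof.
move=> cp cq; apply: (@closure_inner_eq _ _ G) (cp) => _ [a Aa <-] /=.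
rewrite inner_conj [RHS]inner_conj; congr (_^*).
apply: (@closure_inner_eq _ _ G) (cq) => _ [b Ab <-] /=.
exact: trace_inner.
Qed.

(** For a trace the map a Omega |-> (adj a) Omega is antiunitary, so that the
    positive part P of its polar decomposition is isometric.  Being also
    self-adjoint, P is then its own inverse; applied to x - Px, on which it acts
    as -1, positivity leaves only x = Px. *)
Lemma sqrt_Delta_trivial x y : sqrt_Delta M (x, y) -> x = y.
Proof.
have [_ Psa Ppos] := sqrt_Delta_positive M.
have cG u v : sqrt_Delta M (u, v) -> closure G (u, J v).
  by move=> Puv; rewrite /G (tomita_polar M); exists (u, v).
have Pinner u v x' y' : sqrt_Delta M (u, v) -> sqrt_Delta M (x', y') ->
    inner y' v = inner x' u.
  move=> /cG cu /cG cx; rewrite -antiunitary_inner.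
  exact: (closure_tomita_inner cx cu).
move=> Pxy.
have Pd : sqrt_Delta M (x - y, y - x).
  apply/Psa => u v Puv; rewrite !innerBl (Pinner _ _ _ _ Puv Pxy).
  by rewrite (proj1 (Psa _ _) Pxy u v Puv).
have := Ppos _ _ Pd; rewrite -[y - x]opprB innerNr inner_norm oppr_ge0 => h.
apply/subr0_eq/eqP; rewrite -normr_eq0 -sqrf_eq0.
by rewrite eq_le h exprn_ge0.
Qed.

Lemma conj_vac a : A a -> J (a Om) = adj a Om.
Proof.
move=> Aa; have : closure G (a Om, adj a Om).
  by apply: subset_closure; exists a.
rewrite /G (tomita_polar M) => -[[x y] Pxy /= [<- <-]].
by rewrite (sqrt_Delta_trivial Pxy).
Qed.

Lemma conjJK x : J (J x) = x.
Proof.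
suff : J \o J = id by move=> /(congr1 (@^~ x)).
apply: (dense_op_ext (vac_cyclic S)); last 1 first.
- move=> _ [a Aa <-] /=; rewrite !conj_vac ?adjK//; last exact: (vn_adj vA).
  exact: (vn_bounded vA).
- apply: (@bounded_opI _ _ _ 1) => [k u v|u] /=.
    by rewrite !antiunitary_lin conjCK.
  by rewrite !antiunitary_norm mul1r.
- exact: bounded_op_id.
Qed.

Lemma conj_innerr x y : inner x (J y) = inner y (J x).
Proof. by rewrite -{1}[x]conjJK antiunitary_inner. Qed.

Lemma conj_innerl x y : inner (J x) y = inner (J y) x.
Proof. by rewrite -{1}[y]conjJK antiunitary_inner. Qed.

Lemma mirror_bounded a : bounded_op a -> bounded_op (j a).
Proof.
move=> /adj_bounded ba; have [C C0 hC] := op_bound ba.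
apply: (@bounded_opI _ _ _ C) => [k x y|x]; rewrite /mirror /=.
  by rewrite antiunitary_lin (opP ba) antiunitary_lin conjCK.
by rewrite antiunitary_norm (le_trans (hC _))// antiunitary_norm.
Qed.

Lemma mirror_adj a : bounded_op a -> adj (j a) = j (adj a).
Proof.
move=> ba; apply: adj_unique; first exact: mirror_bounded.
move=> x y; rewrite /mirror /= adjK// conj_innerl -adjP//.
exact: conj_innerr.
Qed.

Lemma mirrorK a : bounded_op a -> j (j a) = a.
Proof.
move=> ba; apply/funext => x; rewrite {1}/mirror mirror_adj//.
by rewrite /mirror /= adjK// !conjJK.
Qed.

Lemma mirror_comp a b : bounded_op a -> bounded_op b ->
  j (a \o b) = j b \o j a.
Proof.
by move=> ba bb; apply/funext => x; rewrite /mirror adj_comp//= conjJK.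
Qed.

Lemma mirror_lin (k : R[i]) a b : bounded_op a -> bounded_op b ->
  j (k *: a + b) = k *: j a + j b.
Proof.
move=> ba bb; apply/funext => x; rewrite /mirror adj_lin//=.
by rewrite lin_fctE antiunitary_lin conjCK.
Qed.

Lemma mirror_id : j id = id.
Proof. by apply/funext => x; rewrite /mirror adj_id /= conjJK. Qed.

Lemma mirror_vac a b : A a -> A b -> j a (b Om) = b (a Om).
Proof.
move=> Aa Ab; have [ba bb] := (vn_bounded vA Aa, vn_bounded vA Ab).
have Aab := vn_comp vA Ab Aa.
rewrite /mirror /= conj_vac// -[adj a _]/((adj a \o adj b) Om) -adj_comp//.
by rewrite conj_vac ?adjK//; [exact: (vn_bounded vA)|exact: (vn_adj vA)].
Qed.

(** On the vectors b Omega, the operator j(a) is the right multiplication by a,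
    which commutes with the left multiplications. *)
Lemma mirror_commutant a : A a -> commutant A (j a).
Proof.
move=> Aa; have ba := mirror_bounded (vn_bounded vA Aa).
split=> // b Ab; have bb := vn_bounded vA Ab.
apply: (dense_op_ext (vac_cyclic S)); [exact: bounded_op_comp..|].
move=> _ [c Ac <-] /=; rewrite mirror_vac//.
by rewrite -[b (c Om)]/((b \o c) Om) mirror_vac//; exact: (vn_comp vA).
Qed.

Lemma conj_vac_commutant b : commutant A b -> J (b Om) = adj b Om.
Proof.
move=> [bb cb]; apply: (dense_inner_inj (vac_cyclic S)) => _ [a Aa <-].
have ba := vn_bounded vA Aa.
rewrite conj_innerr conj_vac// -!adjP//.
by have /(congr1 (@^~ Om)) /= -> := cb _ Aa.
Qed.

Lemma mirror_vac_commutant b c : commutant A b -> commutant A c ->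
  j b (c Om) = c (b Om).
Proof.
move=> Ab Ac; have [[bb _] [bc _]] := (Ab, Ac).
have Acb := vn_comp vA' Ac Ab.
rewrite /mirror /= conj_vac_commutant// -[adj b _]/((adj b \o adj c) Om).
rewrite -adj_comp// conj_vac_commutant ?adjK//; first by case: Acb.
exact: (vn_adj vA').
Qed.

(** The vectors c Omega with c in A' are dense, since a Omega = j(a) Omega for a
    in A.  On them j(b) acts as the right multiplication by b, by the previous
    lemma; so j(b) commutes with A' and lies in A by the bicommutant property. *)
Lemma mirror_of_commutant b : commutant A b -> A (j b).
Proof.
move=> Ab; have [bb _] := Ab; have bj := mirror_bounded bb.
have [_ _ <-] := alg_von_neumann S; split => // c Ac; have [bc _] := Ac.
apply: (dense_op_ext (vac_cyclic S)); [exact: bounded_op_comp..|].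
move=> _ [a Aa <-] /=.
have -> : a Om = j a Om by have /= -> := mirror_vac Aa (vn_id vA).
have Aj := mirror_commutant Aa.
rewrite mirror_vac_commutant// -[c (j a Om)]/((c \o j a) Om).
by rewrite [RHS]mirror_vac_commutant//; exact: (vn_comp vA').
Qed.

Lemma commutant_mirror b : commutant A b -> exists2 c, A c & b = j c.
Proof.
move=> Ab; exists (j b); first exact: mirror_of_commutant.
by rewrite mirrorK//; case: Ab.
Qed.

End Trace.
End Conjugation.

(** * Conditional expectation and correlations *)

Section Expectation.
Context {R : realType} {S : system R}.
Local Notation H := (sys_space S).
Local Notation A := (sys_alg S).
Local Notation Om := (sys_vac S).
Local Notation alpha := (sys_dyn S).
Implicit Types (a b c f g x y : H -> H).

Local Notation vA := (alg_von_neumann S).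

Lemma sys_bounded a : A a -> bounded_op a.
Proof. exact: (vn_bounded vA). Qed.

Lemma state_lin (k : R[i]) a b : state S (k *: a + b) = k * state S a + state S b.
Proof. by rewrite /state /vector_state lin_fctE innerDr innerZr. Qed.

Lemma state_adj a : A a -> state S (adj a) = (state S a)^*.
Proof.
by move=> /sys_bounded ba; rewrite /state /vector_state -adjP// -inner_conj.
Qed.

Lemma state_sqr_abs a : A a -> state S (sqr_abs a) = `|a Om| ^+ 2.
Proof. by move=> Aa; rewrite -inner_norm vac_inner. Qed.

Lemma dyn_in a : A a -> A (alpha a).
Proof. by case: (dyn_bij S) => + _ _; apply. Qed.

Lemma dyn_iter_in n a : A a -> A (iter n alpha a).
Proof. by move=> Aa; elim: n => //= n; exact: dyn_in. Qed.

Lemma dyn_iter_adj n a : A a -> iter n alpha (adj a) = adj (iter n alpha a).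
Proof.
by move=> Aa; elim: n => //= n ->; rewrite dyn_adj//; exact: dyn_iter_in.
Qed.

Lemma sys_alg0 : A 0.
Proof. by rewrite -[0](subrr id); apply: (vnB vA); exact: (vn_id vA). Qed.

Lemma adj0 : adj (0 : H -> H) = 0.
Proof.
apply: adj_unique; first exact: (sys_bounded sys_alg0).
by move=> x y; rewrite inner0l innerr0.
Qed.

Lemma dyn0 : alpha 0 = 0.
Proof.
apply: (addrI (alpha 0)); rewrite -{1}[alpha 0]scale1r -dyn_linear//;
  by [rewrite scaler0 !addr0|exact: sys_alg0].
Qed.

Lemma state_dyn a : A a -> state S (alpha a) = state S a.
Proof. exact: dyn_state. Qed.

Lemma dyn_iter_norm n a : A a -> `|iter n alpha a Om| = `|a Om|.
Proof.
move=> Aa; elim: n => //= n <-; have An := dyn_iter_in n Aa.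
apply: norm_inner_eq; rewrite !vac_inner//; last exact: dyn_in.
have An' := vn_adj vA An.
by rewrite -dyn_adj// -dyn_mul// state_dyn//; exact: (vn_comp vA).
Qed.

Section Trace.
Hypothesis tr : tracial S.
Context {F : set (H -> H)} {D : (H -> H) -> (H -> H)}.
Hypotheses (sF : subsystem F) (hD : is_cond_exp F D).

Let vF : von_neumann F. Proof. by case: sF. Qed.
Let FA : F `<=` A. Proof. by case: sF. Qed.
Let DF a : A a -> F (D a). Proof. exact: (cond_exp_in hD). Qed.
Let DA a : A a -> A (D a). Proof. by move=> Aa; exact/FA/DF. Qed.

Lemma cond_exp_mull f a : F f -> A a -> D (f \o a) = f \o D a.
Proof. by move=> Ff Aa; have := cond_exp_module hD Ff Aa (vn_id vF). Qed.

Lemma cond_exp_state_mull f a : F f -> A a ->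
  state S (f \o D a) = state S (f \o a).
Proof.
move=> Ff Aa; rewrite -cond_exp_mull// (cond_exp_state hD)//.
by apply: (vn_comp vA) => //; exact: FA.
Qed.

(** D(a) is the orthogonal projection of a onto F for the inner product of the
    state: the difference d - D(a) lies in F and is orthogonal to F, hence to
    itself, and it vanishes since Omega is separating. *)
Lemma cond_exp_unique a d : A a -> F d ->
  (forall f, F f -> state S (f \o d) = state S (f \o a)) -> D a = d.
Proof.
move=> Aa Fd h; apply/esym/subr0_eq.
have Fe : F (d - D a) by apply: (vnB vF) => //; exact: DF.
apply: vac_separating; first exact: FA.
apply: inner_eq0; rewrite vac_inner; last exact: FA.
have Fe' := vn_adj vF Fe; have be := vn_bounded vF Fe'.
have -> : adj (d - D a) \o (d - D a) =
    (-1) *: (adj (d - D a) \o D a) + (adj (d - D a) \o d).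
  apply/funext => x; rewrite lin_fctE /= -[(d - D a) x]/(d x - D a x) (opB be).
  by rewrite scaleN1r addrC.
by rewrite state_lin cond_exp_state_mull// h// mulN1r addNr.
Qed.

Lemma cond_exp_adj a : A a -> D (adj a) = adj (D a).
Proof.
move=> Aa; apply: cond_exp_unique; first exact: (vn_adj vA).
  by apply: (vn_adj vF); exact: DF.
move=> f Ff; have Af := FA Ff; have Ff' := vn_adj vF Ff.
have e b : A b -> state S (f \o adj b) = (state S (adj f \o b))^*.
  move=> Ab; rewrite -state_adj; last by apply: (vn_comp vA) => //; exact: FA.
  have bf := sys_bounded Af; have bf' := adj_bounded bf.
  have bb := sys_bounded Ab.
  by rewrite adj_comp// adjK// tr//; exact: (vn_adj vA).
by rewrite !e ?cond_exp_state_mull//; exact: DA.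
Qed.

Lemma cond_exp_norm a : A a -> `|D a Om| <= `|a Om|.
Proof.
move=> Aa; have [->|n0] := eqVneq (D a Om) 0; first by rewrite normr0.
have n1 : 0 < `|D a Om| by rewrite normr_gt0.
rewrite -(ler_pM2l n1) -expr2 -inner_norm vac_inner; last exact: DA.
rewrite cond_exp_state_mull//; last by apply: (vn_adj vF); exact: DF.
rewrite -vac_inner; last exact: DA.
rewrite (le_trans _ (cauchy_schwarz _ _))// ger0_norm//.
rewrite vac_inner; last exact: DA.
rewrite -cond_exp_state_mull//; last by apply: (vn_adj vF); exact: DF.
by rewrite -vac_inner ?inner_norm ?exprn_ge0//; exact: DA.
Qed.

Lemma cond_exp_dyn a : A a -> D (alpha a) = alpha (D a).
Proof.
have [_ _ aF] := sF; move=> Aa; apply: cond_exp_unique; first exact: dyn_in.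
  by rewrite -aF; exists (D a) => //; exact: DF.
move=> f; rewrite -{1}aF => -[g Fg <-]; have Ag := FA Fg; have ADa := DA Aa.
rewrite -!dyn_mul// !state_dyn ?cond_exp_state_mull//; exact: (vn_comp vA).
Qed.

Lemma cond_exp_dyn_eq0 n a : A a -> D a = 0 -> D (iter n alpha a) = 0.
Proof.
move=> Aa D0; elim: n => //= n IH.
by rewrite cond_exp_dyn ?IH ?dyn0//; exact: dyn_iter_in.
Qed.

Lemma cond_exp_sub a : A a -> D (a - D a) = 0.
Proof.
move=> Aa; have ADa := DA Aa.
have -> : a - D a = (-1) *: D a + a by rewrite scaleN1r addrC.
rewrite (cond_exp_linear hD)// (cond_exp_id hD) ?scaleN1r ?addNr//; exact: DF.
Qed.

Lemma norm_state_comp x y : A x -> A y ->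
  `|state S (x \o y)| <= `|x Om| * `|y Om|.
Proof.
move=> Ax Ay; have Ax' := vn_adj vA Ax; have bx := sys_bounded Ax.
rewrite -(trace_norm tr)// -{1}[x]adjK// -vac_inner//.
exact: cauchy_schwarz.
Qed.

Lemma weakly_mixingP : relatively_weakly_mixing D <->
  forall a b, A a -> A b -> D a = 0 -> D b = 0 ->
  cesaro0 (fun n => `|D (b \o iter n alpha a) Om| ^+ 2).
Proof.
suff e a b : A a -> A b -> (fun n => `|D (b \o iter n alpha a) Om| ^+ 2) =
    (fun n => state S (sqr_abs (D (b \o iter n alpha a)))).
  split=> h a b Aa Ab Da Db; first by rewrite e//; exact: h.
  by have := h a b Aa Ab Da Db; rewrite e.
move=> Aa Ab; apply/funext => n; rewrite state_sqr_abs//; apply: DA.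
by apply: (vn_comp vA) => //; exact: dyn_iter_in.
Qed.

(** The inner product of gamma(a' (x) j(c')) and W^n gamma(a (x) j(c)) in the
    relative product, written in A. *)
Definition correlation a a' c c' n : R[i] :=
  state S (D (adj a' \o iter n alpha a) \o D (iter n alpha c \o adj c')).

(** Subtracting from adj a' its conditional expectation does not change
    D((adj a') alpha^n(a)), which brings this factor into the scope of relative
    weak mixing; the other factor stays bounded in the norm of the trace. *)
Lemma weakly_mixing_correlation a a' c c' : relatively_weakly_mixing D ->
  A a -> A a' -> A c -> A c' -> D a = 0 -> cesaro0 (correlation a a' c c').
Proof.
move=> /weakly_mixingP wm Aa Aa' Ac Ac' Da.
have Ab := vn_adj vA Aa'; have FDb := DF Ab; have ADb := DA Ab.
have Ab0 := vnB vA Ab ADb.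
have Ad := vn_adj vA Ac'.
have [C C0 hC] := op_bound (sys_bounded Ac').
have := wm _ _ Aa Ab0 Da (cond_exp_sub Ab).
have C1 : 0 < C * `|adj c Om| + 1.
  by rewrite ltr_wpDl// mulr_ge0// ltW.
apply: (cesaro0_dominated C1) => // n.
have An := dyn_iter_in n Aa; have Acn := dyn_iter_in n Ac.
have -> : D ((adj a' - D (adj a')) \o iter n alpha a) =
    D (adj a' \o iter n alpha a).
  have -> : (adj a' - D (adj a')) \o iter n alpha a =
      (-1) *: (D (adj a') \o iter n alpha a) + (adj a' \o iter n alpha a).
    apply/funext => x; rewrite lin_fctE /= scaleN1r.
    by rewrite -[(_ - _) _]/(adj a' (iter n alpha a x) - _) addrC.
  rewrite (cond_exp_linear hD); [|exact: (vn_comp vA)..].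
  by rewrite cond_exp_mull// cond_exp_dyn_eq0// [_ \o 0](_ : _ = 0)
    ?scaler0 ?add0r//; apply/funext => x /=; rewrite (op0 (sys_bounded ADb)).
have A1 := vn_comp vA Ab An; have A2 := vn_comp vA Acn Ad.
rewrite /correlation (le_trans (norm_state_comp (DA A1) (DA A2)))// mulrC.
rewrite ler_wpM2r// (le_trans (cond_exp_norm A2))//.
have [bcn bd bc'] := And3 (sys_bounded Acn) (sys_bounded Ad) (sys_bounded Ac').
rewrite -(trace_norm tr)// adj_comp// adjK//= (le_trans (hC _))//.
by rewrite -dyn_iter_adj// dyn_iter_norm ?lerDl//; exact: (vn_adj vA).
Qed.

(** Taking adjoints exchanges the two factors, and thereby the roles of a and
    c. *)
Lemma conj_correlation a a' c c' n : A a -> A a' -> A c -> A c' ->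
  (correlation (adj c) (adj c') (adj a) (adj a') n)^* = correlation a a' c c' n.
Proof.
move=> Aa Aa' Ac Ac'.
have An := dyn_iter_in n Aa; have Acn := dyn_iter_in n Ac.
have Ab := vn_adj vA Aa'; have Ad := vn_adj vA Ac'.
have A1 := vn_comp vA Ab An; have A2 := vn_comp vA Acn Ad.
have [A3 A4] := (vn_adj vA (DA A1), vn_adj vA (DA A2)).
have [bn bcn] := (sys_bounded An, sys_bounded Acn).
have [bb bd] := (sys_bounded Ab, sys_bounded Ad).
rewrite /correlation !dyn_iter_adj// -!adj_comp// !cond_exp_adj//.
have [b3 b4] := (sys_bounded (DA A1), sys_bounded (DA A2)).
by rewrite -adj_comp// state_adj ?conjCK//; apply: (vn_comp vA); exact: DA.
Qed.

Lemma weakly_mixing_correlation_r a a' c c' : relatively_weakly_mixing D ->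
  A a -> A a' -> A c -> A c' -> D c = 0 -> cesaro0 (correlation a a' c c').
Proof.
move=> wm Aa Aa' Ac Ac' Dc.
have -> : correlation a a' c c' =
    (fun n => (correlation (adj c) (adj c') (adj a) (adj a') n)^*).
  by apply/funext => n; rewrite conj_correlation.
apply/cesaro0_conj/weakly_mixing_correlation => //; try exact: (vn_adj vA).
by rewrite cond_exp_adj// Dc adj0.
Qed.

End Trace.
End Expectation.
Arguments correlation {R S} D a a' c c' n.

(** * The relative product *)

Section Tensor.
Context {R : realType} {H : hilbertType R} {A B : set (H -> H)}.
Context (T : tensor_product A B).

Lemma tens_liftP (X : lmodType R[i]) (beta : (H -> H) -> (H -> H) -> X) :
  bilinear_on A B beta ->
  forall a b, A a -> B b -> tens_lift T beta (tens T a b) = beta a b.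
Proof.
move=> /(tens_exists T) [f hf].
have [_ h] := @xgetPex _ (fun=> 0) [set f : T -> X | linear f /\
  forall a b, A a -> B b -> f (tens T a b) = beta a b]
  (ex_intro _ (f : T -> X) (conj (@linearP _ _ _ _ f) hf)).
exact: h.
Qed.

Context {omega : T -> R[i]} (G : gns_triple omega).
Local Notation K := (gns_space G).
Local Notation gamma t := (gns_rep G t (gns_vec G)).

Lemma gns_vector_lin (k : R[i]) s t :
  gamma (k *: s + t) = k *: gamma s + gamma t.
Proof. by rewrite gns_linear. Qed.

Lemma gns_vector_inner s t : inner (gamma s) (gamma t) = omega (tens_star s * t).
Proof.
rewrite (gns_state G) /vector_state gns_mul gns_star /= -adjP//.
exact: gns_bounded.
Qed.

(** The elementary tensors span the tensor product, here in the dual form of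
    the universal property: a functional vanishing on them is zero. *)
Lemma gns_total (E : set K) : subspace_set E -> closure E `<=` E ->
  (forall a b, A a -> B b -> E (gamma (tens T a b))) -> forall x, E x.
Proof.
move=> Es Ecl Et x; have [v Ev vP] := projection_theorem x Es Ecl.
set h := x - v in vP.
have lin : linear (fun t : T => inner h (gamma t) : R[i]^o).
  by move=> k s t; rewrite gns_vector_lin innerDr innerZr.
pose phi : {linear T -> R[i]^o} := HB.pack
  (fun t : T => inner h (gamma t) : R[i]^o)
  (GRing.isLinear.Build _ _ _ _ (fun t : T => inner h (gamma t) : R[i]^o) lin).
have phi0 : phi =1 (\0 : {linear T -> R[i]^o}).
  apply: tens_unique => a b Aa Bb /=.
  by rewrite inner_conj (vP _ (Et _ _ Aa Bb)) rmorph0.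
have /subr0_eq -> // : h = 0.
apply: (dense_orthogonal_eq0 (gns_cyclic G)) => _ [t _ <-].
by have /= e := phi0 t; rewrite inner_conj e rmorph0.
Qed.

End Tensor.

Section RelativeProduct.
Context {R : realType} {S : system R} (M : modular_data S).
Local Notation H := (sys_space S).
Local Notation A := (sys_alg S).
Local Notation A' := (commutant (sys_alg S)).
Local Notation Om := (sys_vac S).
Local Notation alpha := (sys_dyn S).
Local Notation j := (mirror M).
Context {F : set (H -> H)} {D : (H -> H) -> (H -> H)} {U : H -> H}.
Hypotheses (tr : tracial S) (sF : subsystem F) (hD : is_cond_exp F D).
Hypothesis hU : implements_dyn U.
Context (T : tensor_product A A') (TF : tensor_product F (mirror_sub M F)).
Implicit Types (a b c f g : H -> H).

Local Notation vA := (alg_von_neumann S).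
Let vF : von_neumann F. Proof. by case: sF. Qed.
Let FA : F `<=` A. Proof. by case: sF. Qed.
Let DF a : A a -> F (D a). Proof. exact: (cond_exp_in hD). Qed.
Let DA a : A a -> A (D a). Proof. by move=> Aa; exact/FA/DF. Qed.
Let A'id : A' id. Proof. exact: commutant_id. Qed.
Let jA' c : A c -> A' (j c). Proof. exact: mirror_commutant. Qed.

Lemma delta_tens f g : F f -> mirror_sub M F g ->
  delta (tens TF f g) = f \o g.
Proof.
apply: tens_liftP; split=> [//|k f' g1 g2 Ff _ _].
have bf := vn_bounded vF Ff.
by apply/funext => x; rewrite /= lin_fctE (opP bf).
Qed.

Lemma mirror_exp_in b : A' b -> mirror_sub M F (mirror_exp M D b).
Proof.
by move=> Ab; exists (D (j b)) => //; apply: DF; exact: mirror_of_commutant.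
Qed.

Lemma product_exp_tens a b : A a -> A' b ->
  product_exp D TF (tens T a b) = tens TF (D a) (mirror_exp M D b).
Proof.
have [tl trr] := tens_bilinear TF.
apply: tens_liftP; split=> [k a1 a2 b' Aa1 Aa2 Ab|k a1 b1 b2 Aa1 Ab1 Ab2].
  by rewrite (cond_exp_linear hD)// tl//; do ?exact: DF; exact: mirror_exp_in.
rewrite -trr; [|exact: DF|exact: mirror_exp_in..].
congr (tens TF _ _); rewrite /mirror_exp /=.
have [[bb1 _] [bb2 _]] := (Ab1, Ab2).
have [Aj1 Aj2] : A (j b1) /\ A (j b2) by split; exact: mirror_of_commutant.
rewrite mirror_lin// (cond_exp_linear hD)// mirror_lin//;
  apply: sys_bounded; exact: DA.
Qed.

Lemma product_state_tens a c : A a -> A c ->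
  product_state D T TF (tens T a (j c)) = state S (D a \o D c).
Proof.
move=> Aa Ac; have Ajc := jA' Ac.
rewrite /product_state /= /Delta_state product_exp_tens// delta_tens//;
  [|exact: DF|exact: mirror_exp_in].
rewrite /mirror_exp /= (mirrorK tr (sys_bounded Ac)).
rewrite /state /vector_state /=.
by have /= -> := mirror_vac tr (DA Ac) (vn_id vA).
Qed.

Lemma commutant_dyn_mirror c : A c -> commutant_dyn U (j c) = j (alpha c).
Proof.
move=> Ac; have [uU UOm] := hU; have bU := unitary_bounded uU.
have [bj _] := jA' Ac; have [bj' _] := jA' (dyn_in Ac).
apply: (dense_op_ext (vac_cyclic S)) => //.
  exact: bounded_op_comp (bounded_op_comp bU bj) (adj_bounded bU).
move=> _ [x Ax <-]; have [_ _ /(_ x Ax) [y Ay <-]] := dyn_bij S.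
have UK z : adj U (U z) = z.
  by apply: inner_inj => w; rewrite -adjP// (unitary_inner uU).
have e : U (y (c Om)) = alpha y (alpha c Om).
  by have := UOm _ (vn_comp vA Ay Ac); rewrite dyn_mul.
rewrite /commutant_dyn /= -(UOm y Ay) UK (mirror_vac tr Ac Ay) e (UOm y Ay).
by rewrite (mirror_vac tr (dyn_in Ac) (dyn_in Ay)).
Qed.

Lemma product_dyn_tens a c : A a -> A c ->
  product_dyn U (tens T a (j c)) = tens T (alpha a) (j (alpha c)).
Proof.
move=> Aa Ac; rewrite -commutant_dyn_mirror//.
have [tl trr] := tens_bilinear T.
have cd b : A' b -> A' (commutant_dyn U b).
  move=> /(commutant_mirror tr (M := M)) [d Ad ->].
  by rewrite commutant_dyn_mirror//; apply: jA'; exact: dyn_in.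
have bU := unitary_bounded hU.1.
apply: (tens_liftP T _ Aa (jA' Ac)).
split=> [k a1 a2 b Aa1 Aa2 Ab|k a1 b1 b2 Aa1 Ab1 Ab2].
  by rewrite dyn_linear// tl//; [exact: dyn_in|exact: dyn_in|exact: cd].
rewrite -trr; [|exact: dyn_in|exact: cd..].
congr (tens T _ _); apply/funext => x.
by rewrite /commutant_dyn /= !lin_fctE (opP bU).
Qed.

Context (G : gns_triple (product_state D T TF)).
Local Notation gamma := (@gns_gamma _ _ _ _ _ _ _ G).
Local Notation Klam := (@gns_sub _ _ _ _ _ _ _ G).

Lemma gns_inner_tens a a' c c' : A a -> A a' -> A c -> A c' ->
  inner (gamma (tens T a' (j c'))) (gamma (tens T a (j c))) =
  state S (D (adj a' \o a) \o D (c \o adj c')).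
Proof.
move=> Aa Aa' Ac Ac'; have Ad := vn_adj vA Ac'; have Ab := vn_adj vA Aa'.
have [bc' bd bc] := And3 (sys_bounded Ac') (sys_bounded Ad) (sys_bounded Ac).
have [jc jc' jd] := And3 (jA' Ac) (jA' Ac') (jA' Ad).
rewrite gns_vector_inner tens_starE// (mirror_adj tr)// tens_mul//.
rewrite -(mirror_comp tr)// product_state_tens//; exact: (vn_comp vA).
Qed.

Lemma gns_gamma_lin (k : R[i]) s t :
  gamma (k *: s + t) = k *: gamma s + gamma t.
Proof. exact: gns_vector_lin. Qed.

Lemma gns_sub_subspace : subspace_set (Klam).
Proof.
have [tl _] := tens_bilinear T.
apply: closure_subspace.
apply: (@subspace_setI _ _ _ (gamma (tens T id id))).
  by exists id => //; exact: (vn_id vF).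
move=> k _ _ [f Ff <-] [g Fg <-]; exists (k *: f + g); first exact: (vn_lin vF).
by rewrite tl//; [rewrite gns_gamma_lin|exact: FA..].
Qed.

(** The squared norms of the two vectors and their inner product coincide,
    because the state is a trace. *)
Lemma gns_tens_subalgebra f g : F f -> F g ->
  gamma (tens T f (j g)) = gamma (tens T (f \o g) id).
Proof.
move=> Ff Fg; have [Af Ag] := (FA Ff, FA Fg); have Afg := vn_comp vA Af Ag.
have Aid := vn_id vA; have Fid := vn_id vF.
rewrite -[in RHS](mirror_id (M := M) tr).
have [Ff' Fg'] := (vn_adj vF Ff, vn_adj vF Fg).
have [bf bg] := (sys_bounded Af, sys_bounded Ag).
have Ffg := vn_comp vF Ff Fg; have Ffg' := vn_adj vF Ffg.
have Fid' := vn_adj vF Fid.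
have Dm x y : F x -> F y -> D (x \o y) = x \o y.
  by move=> Fx Fy; rewrite (cond_exp_id hD)//; exact: (vn_comp vF).
apply: inner_eq; rewrite !gns_inner_tens// !Dm//.
rewrite adj_id adj_comp//.
have -> : (adj g \o adj f) \o (f \o g) \o (id \o id) =
    adj g \o (adj f \o f \o g) by [].
rewrite tr//; first exact: (vn_adj vA).
exact: FA (vn_comp vF (vn_comp vF Ff' Ff) Fg).
Qed.

Context {W : gns_space G -> gns_space G}.
Hypothesis hW : implements_product_dyn U W.

Let uW : unitary W. Proof. by case: hW. Qed.

Lemma iter_product_dyn n a c : A a -> A c ->
  iter n W (gamma (tens T a (j c))) =
  gamma (tens T (iter n alpha a) (j (iter n alpha c))).
Proof.
move=> Aa Ac; have [_ Wg] := hW; elim: n => //= n ->.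
by rewrite Wg product_dyn_tens//; exact: dyn_iter_in.
Qed.

Lemma gns_correlation n a a' c c' : A a -> A a' -> A c -> A c' ->
  inner (gamma (tens T a' (j c'))) (iter n W (gamma (tens T a (j c)))) =
  correlation D a a' c c' n.
Proof.
move=> Aa Aa' Ac Ac'.
by rewrite iter_product_dyn// gns_inner_tens//; exact: dyn_iter_in.
Qed.

Lemma gns_sub_orthogonal a c : A a -> A c -> D a = 0 \/ D c = 0 ->
  forall v, Klam v -> inner v (gamma (tens T a (j c))) = 0.
Proof.
move=> Aa Ac D0; apply: closure_orthogonal => _ [f Ff <-].
have Ff' := vn_adj vF Ff; have Af := FA Ff; have bf' := sys_bounded (FA Ff').
rewrite -(mirror_id (M := M) tr) gns_inner_tens//; last exact: (vn_id vA).
rewrite adj_id (cond_exp_mull sF hD)//.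
have -> : c \o id = c by [].
have bDa := sys_bounded (DA Aa).
rewrite /state /vector_state /=.
by case: D0 => ->; rewrite ?(op0 bDa) ?(op0 bf') innerr0.
Qed.

(** The correlations of a fixed point x with the orbit of a vector are constant.
    Relative weak mixing makes the Cesaro means of the correlations tend to zero
    when x is replaced by an elementary tensor, and so, by totality, for x. *)
Lemma fixed_orthogonal a c : relatively_weakly_mixing D ->
  A a -> A c -> D a = 0 \/ D c = 0 ->
  forall x, W x = x -> inner x (gamma (tens T a (j c))) = 0.
Proof.
move=> wm Aa Ac D0 x Wx; set g := gamma _.
have wC n : `|iter n W g| <= `|g| by rewrite (unitary_iter_norm uW).
apply: cesaro0_cst.
have -> : (fun=> inner x g) = (fun n => inner x (iter n W g)).
  apply/funext => n; rewrite -(unitary_iter_inner uW n).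
  by congr inner; elim: n => //= n ->.
apply: (gns_total (subspace_cesaro0 _) (closed_cesaro0 wC)) => a' b' Aa' Ab'.
have [c' Ac' ->] := commutant_mirror tr (M := M) Ab'.
rewrite /=.
have -> : (fun n => inner (gamma (tens T a' (j c'))) (iter n W g)) =
    correlation D a a' c c'.
  by apply/funext => n; rewrite gns_correlation.
case: D0 => D0; first exact: (weakly_mixing_correlation tr sF hD).
exact: (weakly_mixing_correlation_r tr sF hD).
Qed.

Lemma ergodic_of_weakly_mixing :
  relatively_weakly_mixing D -> relatively_ergodic W.
Proof.
move=> wm x Wx.
have [|v Kv vP] := projection_theorem x gns_sub_subspace.
  by rewrite /gns_sub closureK.
set h := x - v in vP.
have h0 a c : A a -> A c -> D a = 0 \/ D c = 0 ->
    inner (gamma (tens T a (j c))) h = 0.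
  move=> Aa Ac D0; rewrite inner_conj innerBl (fixed_orthogonal wm Aa Ac D0 Wx).
  by rewrite (gns_sub_orthogonal Aa Ac D0 Kv) subr0 rmorph0.
have /subr0_eq -> // : h = 0.
apply: inner_eq0.
(* the elementary tensors are total, so it suffices that they are orthogonal
   to h *)
have cl : closure [set y | inner y h = 0] `<=` [set y | inner y h = 0].
  exact: closure_orthogonal.
apply: (gns_total (subspace_orthogonal h) cl) => a b Aa Ab.
have [c Ac ->] := commutant_mirror tr (M := M) Ab; rewrite /=.
have [tl trr] := tens_bilinear T.
have [Fa Fc] := (DF Aa, DF Ac); have [ADa ADc] := (FA Fa, FA Fc).
have Aa0 := vnB vA Aa ADa; have Ac0 := vnB vA Ac ADc.
have split1 d : 1 *: (d - D d) + D d = d by rewrite scale1r subrK.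
have -> : tens T a (j c) = 1 *: tens T (a - D a) (j c) +
    (1 *: tens T (D a) (j (c - D c)) + tens T (D a) (j (D c))).
  rewrite -trr//; try exact: jA'.
  rewrite -mirror_lin; [|exact: sys_bounded..].
  by rewrite split1 -tl//; [rewrite split1|exact: jA'].
rewrite -[gns_rep _ _ _]/(gamma _) !gns_gamma_lin !innerDl !innerZl.
have [Da0 Dc0] := (cond_exp_sub sF hD Aa, cond_exp_sub sF hD Ac).
rewrite (h0 _ _ Aa0 Ac (or_introl Da0)) (h0 _ _ ADa Ac0 (or_intror Dc0)).
rewrite !mulr0 !add0r gns_tens_subalgebra//.
apply: vP; apply: subset_closure; exists (D a \o D c) => //.
exact: (vn_comp vF).
Qed.

Lemma weakly_mixing_of_ergodic :
  relatively_ergodic W -> relatively_weakly_mixing D.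
Proof.
move=> erg; apply/(weakly_mixingP sF hD) => a b Aa Ab Da Db.
have [Aa' Ab'] := (vn_adj vA Aa, vn_adj vA Ab).
have Db' : D (adj b) = 0.
  by rewrite (cond_exp_adj tr sF hD)// Db adj0.
(* with these tensors the two factors of the correlation are mutually adjoint *)
have -> : (fun n => `|D (b \o iter n alpha a) Om| ^+ 2) =
    (fun n => inner (gamma (tens T (adj b) (j b)))
                    (iter n W (gamma (tens T a (j (adj a)))))).
  apply/funext => n; have An := dyn_iter_in n Aa.
  have Abn := vn_comp vA Ab An.
  have [bb bn] := (sys_bounded Ab, sys_bounded An).
  rewrite gns_correlation// /correlation adjK// dyn_iter_adj// -adj_comp//.
  rewrite (cond_exp_adj tr sF hD)// tr; [|exact: DA|exact/(vn_adj vA)/DA].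
  by rewrite -state_sqr_abs//; exact: DA.
apply: (mean_ergodic uW) => x /erg Kx.
by rewrite inner_conj (gns_sub_orthogonal Ab' Ab (or_introl Db') Kx) rmorph0.
Qed.

End RelativeProduct.

Theorem theorem4p2 (R : realType) (S : system R) (M : modular_data S)
  (F : set (sys_space S -> sys_space S))
  (D : (sys_space S -> sys_space S) -> (sys_space S -> sys_space S))
  (U : sys_space S -> sys_space S)
  (T : tensor_product (sys_alg S) (commutant (sys_alg S)))
  (TF : tensor_product F (mirror_sub M F))
  (G : gns_triple (product_state D T TF))
  (W : gns_space G -> gns_space G) :
  tracial S ->
  modular_subsystem M F ->
  is_cond_exp F D ->
  implements_dyn U ->
  implements_product_dyn U W ->
  relatively_weakly_mixing D <-> relatively_ergodic W.
Proof.
move=> tr [sF _] hD hU hW; split.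
  exact: (ergodic_of_weakly_mixing tr sF hD hU hW).
exact: (weakly_mixing_of_ergodic tr sF hD hU hW).
Qed.
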